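(* Let $\mathsf{C}$ be a strict braided monoidal category and let $A$ be a cocommutative Hopf algebra in $\mathsf{C}$. The categories $\mathsf{cocHBr}(A)$, $\mathsf{MP}(A)$ and $\mathsf{coc}\text{-}\mathsf{opBT}(A)$ are isomorphic.
   Context: **Conventions.** $\mathsf{C}$ is a strict braided monoidal category with tensor product $\otimes$, unit object $K$ and braiding $c$. An object written in the place of a morphism denotes its identity morphism. An algebra $(A,\eta_A,\mu_A)$ in $\mathsf{C}$ is unital and associative; a coalgebra $(C,\varepsilon_C,\delta_C)$ in $\mathsf{C}$ is counital and coassociative. The tensor product of algebras $A,B$ is an algebra with unit $\eta_A\otimes\eta_B$ and product $(\mu_A\otimes\mu_B)\circ(A\otimes c_{B,A}\otimes B)$; the tensor product of coalgebras $C,D$ is a coalgebra with counit $\varepsilon_C\otimes\varepsilon_D$ and coproduct $(C\otimes c_{C,D}\otimes D)\circ(\delta_C\otimes\delta_D)$. A Hopf algebra in $\mathsf{C}$ is a tuple $H=(H,\eta_H,\mu_H,\varepsilon_H,\delta_H,\lambda_H)$ where $(H,\eta_H,\mu_H)$ is an algebra, $(H,\varepsilon_H,\delta_H)$ is a coalgebra, $\eta_H$ and $\mu_H$ are coalgebra morphisms, and the antipode $\lambda_H\colon H\to H$ satisfies $\mu_H\circ(\lambda_H\otimes H)\circ\delta_H=\eta_H\circ\varepsilon_H=\mu_H\circ(H\otimes\lambda_H)\circ\delta_H$. A Hopf algebra morphism is a morphism of $\mathsf{C}$ that is both an algebra and a coalgebra morphism. $H$ is cocommutative if $c_{H,H}\circ\delta_H=\delta_H$.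 Put $\mu_H^{\mathrm{op}}=\mu_H\circ c_{H,H}^{-1}$ (if $H$ is cocommutative then $c_{H,H}\circ c_{H,H}=\mathrm{id}_{H\otimes H}$ by a result of Schauenburg, so $\mu_H^{\mathrm{op}}=\mu_H\circ c_{H,H}$). **Hopf braces.** A Hopf brace $\mathbb{H}=(H_1,H_2)$ in $\mathsf{C}$ consists of two Hopf algebras $H_1=(H,\eta_H^1,\mu_H^1,\varepsilon_H,\delta_H,\lambda_H^1)$ and $H_2=(H,\eta_H^2,\mu_H^2,\varepsilon_H,\delta_H,\lambda_H^2)$ in $\mathsf{C}$ with the same underlying coalgebra such that $$\mu_H^2\circ(H\otimes\mu_H^1)=\mu_H^1\circ(\mu_H^2\otimes\Gamma_{H_1})\circ(H\otimes c_{H,H}\otimes H)\circ(\delta_H\otimes H\otimes H),$$ where $\Gamma_{H_1}=\mu_H^1\circ(\lambda_H^1\otimes\mu_H^2)\circ(\delta_H\otimes H)$. A morphism of Hopf braces $(H_1,H_2)\to(B_1,B_2)$ is a morphism $f\colon H\to B$ in $\mathsf{C}$ such that $f\colon H_1\to B_1$ and $f\colon H_2\to B_2$ are Hopf algebra morphisms. For a cocommutative Hopf algebra $A$, $\mathsf{cocHBr}(A)$ is the full subcategory of the category of Hopf braces whose objects are the Hopf braces of the form $(H_1,A)$, i.e. those whose second Hopf algebra $H_2$ is the fixed Hopf algebra $A$. **Opposite brace triples.** Let $A=(A,\eta_A,\mu_A,\varepsilon_A,\delta_A,\lambda_A)$ be a Hopf algebra in $\mathsf{C}$ and let $m_A\colon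 A\otimes A\to A$ and $u_A\colon A\to A$ be morphisms in $\mathsf{C}$. Put $\widetilde{\mu}_A=\mu_A\circ(A\otimes m_A)\circ(\delta_A\otimes A)$. The triple $(A,m_A,u_A)$ is an opposite brace triple if: (i) $m_A$ is a coalgebra morphism; (ii) $m_A\circ(\eta_A\otimes A)=\mathrm{id}_A$; (iii) $m_A\circ(A\otimes\eta_A)=\varepsilon_A\otimes\eta_A$; (iv) $m_A\circ(A\otimes m_A)=m_A\circ(\mu_A^{\mathrm{op}}\otimes A)$; (v) $m_A\circ(A\otimes\widetilde{\mu}_A)=\widetilde{\mu}_A\circ(m_A\otimes m_A)\circ(A\otimes c_{A,A}\otimes A)\circ(\delta_A\otimes A\otimes A)$; (vi) $u_A$ is a coalgebra morphism; (vii) $u_A\circ u_A=\mathrm{id}_A$; (viii) $m_A\circ(A\otimes u_A)\circ\delta_A=\lambda_A$. A morphism of opposite brace triples $(A,m_A,u_A)\to(B,m_B,u_B)$ is a Hopf algebra morphism $f\colon A\to B$ such that $f\circ m_A=m_B\circ(f\otimes f)$. For a cocommutative Hopf algebra $A$, $\mathsf{coc}\text{-}\mathsf{opBT}(A)$ is the full subcategory of the category of opposite brace triples whose objects are those with underlying Hopf algebra the fixed $A$. **Matched pairs.** A left $H$-module $(M,\varphi_M)$ is an object $M$ with $\varphi_M\colon H\otimes M\to M$ such that $\varphi_M\circ(\eta_H\otimes M)=\mathrm{id}_M$ and $\varphi_M\circ(H\otimes\varphi_M)=\varphi_M\circ(\mu_H\otimes M)$; right modules are defined analogously. A left (right) module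 whose underlying object is a coalgebra is a left (right) module coalgebra if its action is a coalgebra morphism. For Hopf algebras $H$ and $A$ in $\mathsf{C}$, and morphisms $\varphi_A\colon H\otimes A\to A$, $\phi_H\colon H\otimes A\to H$, put $$\Psi=(\varphi_A\otimes\phi_H)\circ(H\otimes c_{H,A}\otimes A)\circ(\delta_H\otimes\delta_A)\colon H\otimes A\to A\otimes H.$$ The 4-tuple $(A,H,\varphi_A,\phi_H)$ is a matched pair of Hopf algebras if: (i) $(A,\varphi_A)$ is a left $H$-module coalgebra and $(H,\phi_H)$ is a right $A$-module coalgebra; (ii) $\varphi_A\circ(H\otimes\eta_A)=\varepsilon_H\otimes\eta_A$; (iii) $\phi_H\circ(\eta_H\otimes A)=\eta_H\otimes\varepsilon_A$; (iv) $\varphi_A\circ(H\otimes\mu_A)=\mu_A\circ(A\otimes\varphi_A)\circ(\Psi\otimes A)$; (v) $\phi_H\circ(\mu_H\otimes A)=\mu_H\circ(\phi_H\otimes H)\circ(H\otimes\Psi)$; (vi) $c_{A,H}\circ\Psi=(\phi_H\otimes\varphi_A)\circ(H\otimes c_{H,A}\otimes A)\circ(\delta_H\otimes\delta_A)$. For a cocommutative Hopf algebra $A$, $\mathsf{MP}(A)$ is the category whose objects are the matched pairs of the form $(A,A,\varphi_A,\phi_A)$ satisfying $\mu_A=\mu_A\circ\Psi$, and whose morphisms $(A,A,\varphi_A,\phi_A)\to(A,A,\varphi'_A,\phi'_A)$ are the Hopf algebra morphisms $f\colon A\to A$ such that $f\circ\varphi_A=\varphi'_A\circ(f\otimes f)$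 and $f\circ\phi_A=\phi'_A\circ(f\otimes f)$. *)

(* Defs.v *)
From Stdlib Require Import ProofIrrelevance.

Set Implicit Arguments.
Unset Strict Implicit.
Unset Printing Implicit Defensive.

(** * Categories, functors, isomorphism of categories *)

Record category : Type := Category {
  cat_ob :> Type;
  hom : cat_ob -> cat_ob -> Type;
  idm : forall X, hom X X;
  comp : forall X Y Z, hom Y Z -> hom X Y -> hom X Z;
  comp_idl : forall X Y (f : hom X Y), comp (idm Y) f = f;
  comp_idr : forall X Y (f : hom X Y), comp f (idm X) = f;
  comp_assoc : forall X Y Z W (h : hom Z W) (g : hom Y Z) (f : hom X Y),
    comp h (comp g f) = comp (comp h g) f
}.

Arguments hom {c} X Y.
Arguments idm {c} X.
Arguments comp {c X Y Z} g f.

Notation "g ∘ f" := (comp g f) (at level 40, left associativity).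

Record functor (D E : category) : Type := Functor {
  fob :> D -> E;
  fmap : forall X Y : D, hom X Y -> hom (fob X) (fob Y);
  fmap_id : forall X : D, fmap (idm X) = idm (fob X);
  fmap_comp : forall (X Y Z : D) (g : hom Y Z) (f : hom X Y),
    fmap (g ∘ f) = fmap g ∘ fmap f
}.

Definition functor_id (D : category) : functor D D :=
  @Functor D D (fun X => X) (fun X Y f => f)
    (fun X => eq_refl) (fun X Y Z g f => eq_refl).

Lemma functor_comp_id (D E L : category) (G : functor E L) (F : functor D E) (X : D) :
  fmap G (fmap F (idm X)) = idm (G (F X)).
Proof. now rewrite !fmap_id. Qed.

Lemma functor_comp_comp (D E L : category) (G : functor E L) (F : functor D E)
    (X Y Z : D) (g : hom Y Z) (f : hom X Y) :
  fmap G (fmap F (g ∘ f)) = fmap G (fmap F g) ∘ fmap G (fmap F f).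
Proof. now rewrite !fmap_comp. Qed.

Definition functor_comp (D E L : category) (G : functor E L) (F : functor D E)
    : functor D L :=
  @Functor D L (fun X => G (F X)) (fun X Y f => fmap G (fmap F f))
    (functor_comp_id G F) (functor_comp_comp G F).

Definition isomorphic_categories (D E : category) : Prop :=
  exists (F : functor D E) (G : functor E D),
    functor_comp G F = functor_id D /\ functor_comp F G = functor_id E.

(** The full subcategory of [D] on the objects of the form [F i]; it is used
    below only for families [F] that are injective. *)
Definition full_subcategory (D : category) (I : Type) (F : I -> D) : category :=
  @Category I (fun i j => hom (F i) (F j)) (fun i => idm (F i))
    (fun i j k g f => g ∘ f)
    (fun i j f => comp_idl f) (fun i j f => comp_idr f)
    (fun i j k l h g f => comp_assoc h g f).

(** Objects of [C] equipped with structure (indexed by [I]), with the morphisms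
    of [C] that satisfy [P] as morphisms. *)
Section StructuredObjects.
Variables (C : category) (I : Type) (ob : I -> C).
Variable P : forall i j, hom (ob i) (ob j) -> Prop.
Hypothesis P_id : forall i, P (idm (ob i)).
Hypothesis P_comp : forall i j k (g : hom (ob j) (ob k)) (f : hom (ob i) (ob j)),
  P g -> P f -> P (g ∘ f).

Definition structured_hom (i j : I) : Type := {f : hom (ob i) (ob j) | P f}.

Lemma structured_hom_eq (i j : I) (f g : structured_hom i j) :
  proj1_sig f = proj1_sig g -> f = g.
Proof.
destruct f as [f Pf], g as [g Pg]; simpl; intros e; subst g.
now rewrite (proof_irrelevance _ Pf Pg).
Qed.

Definition structured_id (i : I) : structured_hom i i :=
  exist _ (idm (ob i)) (P_id i).

Definition structured_comp (i j k : I) (g : structured_hom j k)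
    (f : structured_hom i j) : structured_hom i k :=
  exist _ (proj1_sig g ∘ proj1_sig f) (P_comp (proj2_sig g) (proj2_sig f)).

Definition structured_category : category.
Proof.
refine (@Category I structured_hom structured_id structured_comp _ _ _);
  intros; apply structured_hom_eq; simpl.
- apply comp_idl.
- apply comp_idr.
- apply comp_assoc.
Defined.
End StructuredObjects.

(** * Strict braided monoidal categories *)

(** The identity morphism, seen along an equality of objects. *)
Definition eq_hom (C : category) (X Y : C) (e : X = Y) : hom X Y :=
  match e in _ = Z return hom X Z with eq_refl => idm X end.

(** Strictness: associativity and unitality hold as equalities of objects and,
    along these, as equalities of morphisms ([tensm_assoc], [tensm_unitl],
    [tensm_unitr]).  Pentagon and triangle need not be required, since the
    morphisms involved are all of the form [eq_hom _]. *)
Record strict_monoidal_category : Type := StrictMonoidalCategory {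
  smc_cat :> category;
  tens : smc_cat -> smc_cat -> smc_cat;
  tunit : smc_cat;
  tensm : forall X X' Y Y' : smc_cat,
    hom X X' -> hom Y Y' -> hom (tens X Y) (tens X' Y');
  tensm_id : forall X Y : smc_cat, tensm (idm X) (idm Y) = idm (tens X Y);
  tensm_comp : forall (X X' X'' Y Y' Y'' : smc_cat)
      (f' : hom X' X'') (f : hom X X') (g' : hom Y' Y'') (g : hom Y Y'),
    tensm (f' ∘ f) (g' ∘ g) = tensm f' g' ∘ tensm f g;
  tens_assoc : forall X Y Z : smc_cat, tens (tens X Y) Z = tens X (tens Y Z);
  tens_unitl : forall X : smc_cat, tens tunit X = X;
  tens_unitr : forall X : smc_cat, tens X tunit = X;
  tensm_assoc : forall (X X' Y Y' Z Z' : smc_cat)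
      (f : hom X X') (g : hom Y Y') (h : hom Z Z'),
    eq_hom (tens_assoc X' Y' Z') ∘ tensm (tensm f g) h
    = tensm f (tensm g h) ∘ eq_hom (tens_assoc X Y Z);
  tensm_unitl : forall (X X' : smc_cat) (f : hom X X'),
    eq_hom (tens_unitl X') ∘ tensm (idm tunit) f = f ∘ eq_hom (tens_unitl X);
  tensm_unitr : forall (X X' : smc_cat) (f : hom X X'),
    eq_hom (tens_unitr X') ∘ tensm f (idm tunit) = f ∘ eq_hom (tens_unitr X)
}.

Arguments tens {s} X Y.
Arguments tunit {s}.
Arguments tensm {s X X' Y Y'} f g.

Notation "X ⊗ Y" := (tens X Y) (at level 33, left associativity).
Notation "f ⊠ g" := (tensm f g) (at level 33, left associativity).

(** The identities of [X ⊗ Y ⊗ Z] and [X = tunit ⊗ X = X ⊗ tunit], with source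
    and target bracketed as indicated. *)
Section StrictnessIdentities.
Variable C : strict_monoidal_category.

Definition assoc (X Y Z : C) : hom ((X ⊗ Y) ⊗ Z) (X ⊗ (Y ⊗ Z)) :=
  eq_hom (tens_assoc X Y Z).
Definition assocV (X Y Z : C) : hom (X ⊗ (Y ⊗ Z)) ((X ⊗ Y) ⊗ Z) :=
  eq_hom (eq_sym (tens_assoc X Y Z)).
Definition unitl (X : C) : hom (tunit ⊗ X) X := eq_hom (tens_unitl X).
Definition unitlV (X : C) : hom X (tunit ⊗ X) := eq_hom (eq_sym (tens_unitl X)).
Definition unitr (X : C) : hom (X ⊗ tunit) X := eq_hom (tens_unitr X).
Definition unitrV (X : C) : hom X (X ⊗ tunit) := eq_hom (eq_sym (tens_unitr X)).
End StrictnessIdentities.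

Arguments assoc {C} X Y Z.
Arguments assocV {C} X Y Z.
Arguments unitl {C} X.
Arguments unitlV {C} X.
Arguments unitr {C} X.
Arguments unitrV {C} X.

Record strict_braided_category : Type := StrictBraidedCategory {
  sbc_smc :> strict_monoidal_category;
  braid : forall X Y : sbc_smc, hom (X ⊗ Y) (Y ⊗ X);
  braidV : forall X Y : sbc_smc, hom (Y ⊗ X) (X ⊗ Y);
  braidK : forall X Y : sbc_smc, braidV X Y ∘ braid X Y = idm (X ⊗ Y);
  braidVK : forall X Y : sbc_smc, braid X Y ∘ braidV X Y = idm (Y ⊗ X);
  braid_nat : forall (X X' Y Y' : sbc_smc) (f : hom X X') (g : hom Y Y'),
    braid X' Y' ∘ (f ⊠ g) = (g ⊠ f) ∘ braid X Y;
  braid_tensl : forall X Y Z : sbc_smc,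
    braid (X ⊗ Y) Z
    = assoc Z X Y ∘ (braid X Z ⊠ idm Y) ∘ assocV X Z Y
      ∘ (idm X ⊠ braid Y Z) ∘ assoc X Y Z;
  braid_tensr : forall X Y Z : sbc_smc,
    braid X (Y ⊗ Z)
    = assocV Y Z X ∘ (idm Y ⊠ braid X Z) ∘ assoc Y X Z
      ∘ (braid X Y ⊠ idm Z) ∘ assocV X Y Z
}.

Arguments braid {s} X Y.
Arguments braidV {s} X Y.

(** [X ⊗ c_{Y,Z} ⊗ W]. *)
Definition braid_mid (C : strict_braided_category) (X Y Z W : C)
    : hom ((X ⊗ Y) ⊗ (Z ⊗ W)) ((X ⊗ Z) ⊗ (Y ⊗ W)) :=
  assocV X Z (Y ⊗ W) ∘ (idm X ⊠ assoc Z Y W)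
  ∘ (idm X ⊠ (braid Y Z ⊠ idm W))
  ∘ (idm X ⊠ assocV Y Z W) ∘ assoc X Y (Z ⊗ W).

Arguments braid_mid {C} X Y Z W.

(** * Algebras, coalgebras, Hopf algebras *)

Section HopfAlgebras.
Variable C : strict_braided_category.

Record algebra_on (X : C) : Type := AlgebraOn {
  eta : hom tunit X;
  mu : hom (X ⊗ X) X;
  mu_unitl : mu ∘ (eta ⊠ idm X) = unitl X;
  mu_unitr : mu ∘ (idm X ⊠ eta) = unitr X;
  mu_assoc : mu ∘ (mu ⊠ idm X) = mu ∘ (idm X ⊠ mu) ∘ assoc X X X
}.

Definition is_algebra_morphism (X Y : C) (A : algebra_on X) (B : algebra_on Y)
    (f : hom X Y) : Prop :=
  f ∘ eta A = eta B /\ f ∘ mu A = mu B ∘ (f ⊠ f).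

(** The operations of a coalgebra are separated from its laws, so that those of
    a tensor product can be used in [is_coalgebra_morphism] directly. *)
Record coalgebra_ops (X : C) : Type := CoalgebraOps {
  counit : hom X tunit;
  comul : hom X (X ⊗ X)
}.

Record is_coalgebra (X : C) (D : coalgebra_ops X) : Prop := IsCoalgebra {
  comul_unitl : (counit D ⊠ idm X) ∘ comul D = unitlV X;
  comul_unitr : (idm X ⊠ counit D) ∘ comul D = unitrV X;
  comul_assoc : assoc X X X ∘ (comul D ⊠ idm X) ∘ comul D = (idm X ⊠ comul D) ∘ comul D
}.

Definition is_coalgebra_morphism (X Y : C) (D : coalgebra_ops X) (E : coalgebra_ops Y)
    (f : hom X Y) : Prop :=
  counit E ∘ f = counit D /\ comul E ∘ f = (f ⊠ f) ∘ comul D.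

Definition unit_coalgebra : coalgebra_ops (@tunit C) :=
  CoalgebraOps (idm tunit) (unitlV tunit).

Definition tens_coalgebra (X Y : C) (D : coalgebra_ops X) (E : coalgebra_ops Y)
    : coalgebra_ops (X ⊗ Y) :=
  CoalgebraOps (unitl tunit ∘ (counit D ⊠ counit E))
               (braid_mid X X Y Y ∘ (comul D ⊠ comul E)).

Record coalgebra : Type := Coalgebra {
  coalg_ob :> C;
  coalg_ops :> coalgebra_ops coalg_ob;
  coalg_laws : is_coalgebra coalg_ops
}.

Record hopf_on (H : coalgebra) : Type := HopfOn {
  hopf_alg :> algebra_on H;
  antip : hom H H;
  eta_coalg : is_coalgebra_morphism unit_coalgebra H (eta hopf_alg);
  mu_coalg : is_coalgebra_morphism (tens_coalgebra H H) H (mu hopf_alg);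
  antipl : mu hopf_alg ∘ (antip ⊠ idm H) ∘ comul H = eta hopf_alg ∘ counit H;
  antipr : mu hopf_alg ∘ (idm H ⊠ antip) ∘ comul H = eta hopf_alg ∘ counit H
}.

Record hopf_algebra : Type := HopfAlgebra {
  hopf_coalg :> coalgebra;
  hopf_str :> hopf_on hopf_coalg
}.

Definition is_hopf_morphism (A B : hopf_algebra) (f : hom A B) : Prop :=
  is_algebra_morphism A B f /\ is_coalgebra_morphism A B f.

Definition cocommutative (A : hopf_algebra) : Prop :=
  braid A A ∘ comul A = comul A.

Definition mu_op (X : C) (A : algebra_on X) : hom (X ⊗ X) X := mu A ∘ braidV X X.

Lemma is_hopf_morphism_id (A : hopf_algebra) : is_hopf_morphism (idm A).
Proof. now repeat split; rewrite ?tensm_id, ?comp_idl, ?comp_idr. Qed.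

Lemma is_hopf_morphism_comp (A B D : hopf_algebra) (g : hom B D) (f : hom A B) :
  is_hopf_morphism g -> is_hopf_morphism f -> is_hopf_morphism (g ∘ f).
Proof.
intros [[g1 g2] [g3 g4]] [[f1 f2] [f3 f4]]; repeat split.
- now rewrite <- comp_assoc, f1.
- now rewrite tensm_comp, <- comp_assoc, f2, !comp_assoc, g2.
- now rewrite comp_assoc, g3.
- now rewrite tensm_comp, comp_assoc, g4, <- !comp_assoc, f4.
Qed.

(** * Hopf braces *)

Definition Gamma (H : coalgebra) (H1 H2 : hopf_on H) : hom (H ⊗ H) H :=
  mu H1 ∘ (antip H1 ⊠ mu H2) ∘ assoc H H H ∘ (comul H ⊠ idm H).

Definition brace_law (H : coalgebra) (H1 H2 : hopf_on H) : Prop :=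
  mu H2 ∘ (idm H ⊠ mu H1)
  = mu H1 ∘ (mu H2 ⊠ Gamma H1 H2) ∘ braid_mid H H H H ∘ (comul H ⊠ idm (H ⊗ H)).

Record hopf_brace : Type := HopfBrace {
  hb_coalg : coalgebra;
  hb_fst : hopf_on hb_coalg;
  hb_snd : hopf_on hb_coalg;
  hb_law : brace_law hb_fst hb_snd
}.

Definition hb_hopf1 (X : hopf_brace) : hopf_algebra := HopfAlgebra (hb_fst X).
Definition hb_hopf2 (X : hopf_brace) : hopf_algebra := HopfAlgebra (hb_snd X).

Definition is_hopf_brace_morphism (X Y : hopf_brace)
    (f : hom (hb_coalg X) (hb_coalg Y)) : Prop :=
  @is_hopf_morphism (hb_hopf1 X) (hb_hopf1 Y) f /\
  @is_hopf_morphism (hb_hopf2 X) (hb_hopf2 Y) f.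

Lemma is_hopf_brace_morphism_id (X : hopf_brace) :
  @is_hopf_brace_morphism X X (idm (hb_coalg X)).
Proof.
exact (conj (is_hopf_morphism_id (hb_hopf1 X)) (is_hopf_morphism_id (hb_hopf2 X))).
Qed.

Lemma is_hopf_brace_morphism_comp (X Y Z : hopf_brace)
    (g : hom (hb_coalg Y) (hb_coalg Z)) (f : hom (hb_coalg X) (hb_coalg Y)) :
  is_hopf_brace_morphism g -> is_hopf_brace_morphism f ->
  @is_hopf_brace_morphism X Z (g ∘ f).
Proof.
intros [g1 g2] [f1 f2].
exact (conj (is_hopf_morphism_comp g1 f1) (is_hopf_morphism_comp g2 f2)).
Qed.

Definition HBr : category :=
  structured_category is_hopf_brace_morphism_id is_hopf_brace_morphism_comp.

Definition cocHBr (A : hopf_algebra) : category :=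
  @full_subcategory HBr {H1 : hopf_on A | brace_law H1 A}
    (fun H1 => HopfBrace (proj2_sig H1)).

(** * Opposite brace triples *)

Definition mu_tilde (A : hopf_algebra) (m : hom (A ⊗ A) A) : hom (A ⊗ A) A :=
  mu A ∘ (idm A ⊠ m) ∘ assoc A A A ∘ (comul A ⊠ idm A).

Record is_opposite_brace_triple (A : hopf_algebra)
    (m : hom (A ⊗ A) A) (u : hom A A) : Prop := IsOppositeBraceTriple {
  obt_m_coalg : is_coalgebra_morphism (tens_coalgebra A A) A m;
  obt_m_unitl : m ∘ (eta A ⊠ idm A) = unitl A;
  obt_m_unitr : m ∘ (idm A ⊠ eta A) = unitl A ∘ (counit A ⊠ eta A);
  obt_m_assoc : m ∘ (idm A ⊠ m) ∘ assoc A A A = m ∘ (mu_op A ⊠ idm A);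
  obt_m_tilde : m ∘ (idm A ⊠ mu_tilde m)
    = mu_tilde m ∘ (m ⊠ m) ∘ braid_mid A A A A ∘ (comul A ⊠ idm (A ⊗ A));
  obt_u_coalg : is_coalgebra_morphism A A u;
  obt_u_invol : u ∘ u = idm A;
  obt_antip : m ∘ (idm A ⊠ u) ∘ comul A = antip A
}.

Record opposite_brace_triple : Type := OppositeBraceTriple {
  obt_hopf : hopf_algebra;
  obt_m : hom (obt_hopf ⊗ obt_hopf) obt_hopf;
  obt_u : hom obt_hopf obt_hopf;
  obt_laws : is_opposite_brace_triple obt_m obt_u
}.

Definition is_opposite_brace_triple_morphism (X Y : opposite_brace_triple)
    (f : hom (obt_hopf X) (obt_hopf Y)) : Prop :=
  is_hopf_morphism f /\ f ∘ obt_m X = obt_m Y ∘ (f ⊠ f).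

Lemma preserves_id (X : C) (m : hom (X ⊗ X) X) : idm X ∘ m = m ∘ (idm X ⊠ idm X).
Proof. now rewrite tensm_id, comp_idl, comp_idr. Qed.

Lemma preserves_comp (X Y Z : C) (m : hom (X ⊗ X) X) (n : hom (Y ⊗ Y) Y)
    (p : hom (Z ⊗ Z) Z) (g : hom Y Z) (f : hom X Y) :
  g ∘ n = p ∘ (g ⊠ g) -> f ∘ m = n ∘ (f ⊠ f) ->
  (g ∘ f) ∘ m = p ∘ ((g ∘ f) ⊠ (g ∘ f)).
Proof. now intros eg ef; rewrite tensm_comp, <- comp_assoc, ef, !comp_assoc, eg. Qed.

Lemma is_opposite_brace_triple_morphism_id (X : opposite_brace_triple) :
  @is_opposite_brace_triple_morphism X X (idm (obt_hopf X)).
Proof. exact (conj (is_hopf_morphism_id _) (preserves_id _)). Qed.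

Lemma is_opposite_brace_triple_morphism_comp (X Y Z : opposite_brace_triple)
    (g : hom (obt_hopf Y) (obt_hopf Z)) (f : hom (obt_hopf X) (obt_hopf Y)) :
  is_opposite_brace_triple_morphism g -> is_opposite_brace_triple_morphism f ->
  @is_opposite_brace_triple_morphism X Z (g ∘ f).
Proof.
intros [g1 g2] [f1 f2].
exact (conj (is_hopf_morphism_comp g1 f1) (preserves_comp g2 f2)).
Qed.

Definition opBT : category :=
  structured_category
    is_opposite_brace_triple_morphism_id is_opposite_brace_triple_morphism_comp.

Definition coc_opBT (A : hopf_algebra) : category :=
  @full_subcategory opBT
    {t : hom (A ⊗ A) A * hom A A | is_opposite_brace_triple (fst t) (snd t)}
    (fun t => OppositeBraceTriple (proj2_sig t)).

(** * Matched pairs *)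

Definition is_left_module (X : C) (H : algebra_on X) (M : C) (phi : hom (X ⊗ M) M)
    : Prop :=
  phi ∘ (eta H ⊠ idm M) = unitl M /\
  phi ∘ (idm X ⊠ phi) ∘ assoc X X M = phi ∘ (mu H ⊠ idm M).

Definition is_right_module (X : C) (A : algebra_on X) (M : C) (phi : hom (M ⊗ X) M)
    : Prop :=
  phi ∘ (idm M ⊠ eta A) = unitr M /\
  phi ∘ (phi ⊠ idm X) = phi ∘ (idm M ⊠ mu A) ∘ assoc M X X.

Definition is_left_module_coalgebra (H : hopf_algebra) (M : coalgebra)
    (phi : hom (H ⊗ M) M) : Prop :=
  is_left_module H phi /\ is_coalgebra_morphism (tens_coalgebra H M) M phi.

Definition is_right_module_coalgebra (A : hopf_algebra) (M : coalgebra)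
    (phi : hom (M ⊗ A) M) : Prop :=
  is_right_module A phi /\ is_coalgebra_morphism (tens_coalgebra M A) M phi.

Definition Psi (A H : hopf_algebra) (phiA : hom (H ⊗ A) A) (phiH : hom (H ⊗ A) H)
    : hom (H ⊗ A) (A ⊗ H) :=
  (phiA ⊠ phiH) ∘ braid_mid H H A A ∘ (comul H ⊠ comul A).

Record is_matched_pair (A H : hopf_algebra)
    (phiA : hom (H ⊗ A) A) (phiH : hom (H ⊗ A) H) : Prop := IsMatchedPair {
  mp_left : is_left_module_coalgebra phiA;
  mp_right : is_right_module_coalgebra phiH;
  mp_etaA : phiA ∘ (idm H ⊠ eta A) = unitl A ∘ (counit H ⊠ eta A);
  mp_etaH : phiH ∘ (eta H ⊠ idm A) = unitr H ∘ (eta H ⊠ counit A);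
  mp_muA : phiA ∘ (idm H ⊠ mu A) ∘ assoc H A A
    = mu A ∘ (idm A ⊠ phiA) ∘ assoc A H A ∘ (Psi phiA phiH ⊠ idm A);
  mp_muH : phiH ∘ (mu H ⊠ idm A)
    = mu H ∘ (phiH ⊠ idm H) ∘ assocV H A H ∘ (idm H ⊠ Psi phiA phiH) ∘ assoc H H A;
  mp_braid : braid A H ∘ Psi phiA phiH
    = (phiH ⊠ phiA) ∘ braid_mid H H A A ∘ (comul H ⊠ comul A)
}.

Record MP_ob (A : hopf_algebra) : Type := MPOb {
  MP_left : hom (A ⊗ A) A;
  MP_right : hom (A ⊗ A) A;
  MP_matched : @is_matched_pair A A MP_left MP_right;
  MP_mu : mu A = mu A ∘ @Psi A A MP_left MP_right
}.

Definition is_MP_morphism (A : hopf_algebra) (X Y : MP_ob A) (f : hom A A) : Prop :=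
  is_hopf_morphism f /\
  f ∘ MP_left X = MP_left Y ∘ (f ⊠ f) /\
  f ∘ MP_right X = MP_right Y ∘ (f ⊠ f).

Lemma is_MP_morphism_id (A : hopf_algebra) (X : MP_ob A) :
  is_MP_morphism X X (idm A).
Proof.
exact (conj (is_hopf_morphism_id A) (conj (preserves_id _) (preserves_id _))).
Qed.

Lemma is_MP_morphism_comp (A : hopf_algebra) (X Y Z : MP_ob A) (g f : hom A A) :
  is_MP_morphism Y Z g -> is_MP_morphism X Y f -> is_MP_morphism X Z (g ∘ f).
Proof.
intros [g1 [g2 g3]] [f1 [f2 f3]].
exact (conj (is_hopf_morphism_comp g1 f1)
            (conj (preserves_comp g2 f2) (preserves_comp g3 f3))).
Qed.

Definition MP (A : hopf_algebra) : category :=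
  @structured_category C (MP_ob A) (fun _ => A) (@is_MP_morphism A)
    (@is_MP_morphism_id A) (@is_MP_morphism_comp A).

End HopfAlgebras.

(* Main.v *)
Require Import Defs.
From Stdlib Require Import ProofIrrelevance FunctionalExtensionality.
From Corelib Require Import ssreflect.

(** Cocommutative Hopf algebras are group objects among cocommutative coalgebras.
    By Schauenburg's theorem the braiding of [A] with itself is an involution, so
    that the tensor powers of [A] are again cocommutative coalgebras and a morphism
    out of them is determined by its values on points, i.e. on coalgebra morphisms
    [T -> A] with [T] cocommutative.  The points [T -> A] form a group, natural in
    [T], and each of the three structures becomes its set-theoretic counterpart on
    these groups: a skew brace [a (b + c) = ab - a + ac], an action
    [m_a b = a^-1 (a + b)] of the opposite group by automorphisms of [+], or a
    matched pair [ab = (l_a b) (r_a b)] with [l_a = m_(a^-1)].  There the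
    correspondence is elementary group theory, and the Yoneda argument transports
    it back to [C]. *)

Set Implicit Arguments.
Unset Strict Implicit.
Unset Printing Implicit Defensive.

(** * Coherence *)

(** As [C] is only braided, a tensor product of cocommutative coalgebras need not be cocommutative
    unless the double braiding of its factors is trivial. Schauenburg's theorem therefore has to
    come before any argument with several points. The generic points then live on [A], [A ⊗ A] and
    [A ⊗ (A ⊗ A)]: no law has more than three variables. Strictness is given by equations between
    objects, so composites carry transports [eq_hom]; proof irrelevance identifies any two of these
    with the same ends and takes the place of a coherence theorem. Behind the dictionary of groups
    stands one binary operation, the map [λ_a b = -a + ab] of a skew brace. It is the left action
    [l_a] of the matched pair, and [m_a] is [λ] at the inverse of [a]. All other data are recovered
    from it: the sum is [a + b = a (m_a b)], its neutral element is that of the product, [u] is its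
    negation, and [r] is forced by [ab = (l_a b) (r_a b)]. *)

Section EqHom.
Variable C : category.

Lemma eq_hom_refl (X : C) (e : X = X) : eq_hom e = idm X.
Proof. by rewrite (proof_irrelevance _ e eq_refl). Qed.

Lemma eq_hom_comp (X Y Z : C) (e : X = Y) (e' : Y = Z) :
  eq_hom e' ∘ eq_hom e = eq_hom (eq_trans e e').
Proof. by destruct e'; rewrite /= comp_idl. Qed.

Lemma eq_hom_compA (W X Y Z : C) (e : X = Y) (e' : Y = Z) (f : hom W X) :
  eq_hom e' ∘ (eq_hom e ∘ f) = eq_hom (eq_trans e e') ∘ f.
Proof. by rewrite comp_assoc eq_hom_comp. Qed.

Lemma eq_hom_irr (X Y : C) (e e' : X = Y) : eq_hom e = eq_hom e'.
Proof. by rewrite (proof_irrelevance _ e e'). Qed.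

Lemma comp_congr (X Y Z : C) (g g' : hom Y Z) (f f' : hom X Y) :
  g = g' -> f = f' -> g ∘ f = g' ∘ f'.
Proof. by move=> -> ->. Qed.
End EqHom.

Section Strictness.
Variable C : strict_monoidal_category.
Implicit Types X Y Z W V : C.

Lemma eq_hom_tensr X Y Z (e : Y = Z) : idm X ⊠ eq_hom e = eq_hom (f_equal (tens X) e).
Proof. by destruct e; rewrite /= tensm_id. Qed.

Lemma eq_hom_tensl X Y Z (e : Y = Z) :
  eq_hom e ⊠ idm X = eq_hom (f_equal (fun U => U ⊗ X) e).
Proof. by destruct e; rewrite /= tensm_id. Qed.

Lemma assocK X Y Z : assocV X Y Z ∘ assoc X Y Z = idm _.
Proof. by rewrite /assoc /assocV eq_hom_comp eq_hom_refl. Qed.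
Lemma assocVK X Y Z : assoc X Y Z ∘ assocV X Y Z = idm _.
Proof. by rewrite /assoc /assocV eq_hom_comp eq_hom_refl. Qed.
Lemma unitlK X : unitlV X ∘ unitl X = idm _.
Proof. by rewrite /unitl /unitlV eq_hom_comp eq_hom_refl. Qed.
Lemma unitlVK X : unitl X ∘ unitlV X = idm _.
Proof. by rewrite /unitl /unitlV eq_hom_comp eq_hom_refl. Qed.
Lemma unitrK X : unitrV X ∘ unitr X = idm _.
Proof. by rewrite /unitr /unitrV eq_hom_comp eq_hom_refl. Qed.
Lemma unitrVK X : unitr X ∘ unitrV X = idm _.
Proof. by rewrite /unitr /unitrV eq_hom_comp eq_hom_refl. Qed.

Lemma assoc_nat X X' Y Y' Z Z' (f : hom X X') (g : hom Y Y') (h : hom Z Z') :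
  assoc X' Y' Z' ∘ ((f ⊠ g) ⊠ h) = (f ⊠ (g ⊠ h)) ∘ assoc X Y Z.
Proof. exact: tensm_assoc. Qed.

Lemma assocV_nat X X' Y Y' Z Z' (f : hom X X') (g : hom Y Y') (h : hom Z Z') :
  assocV X' Y' Z' ∘ (f ⊠ (g ⊠ h)) = ((f ⊠ g) ⊠ h) ∘ assocV X Y Z.
Proof.
rewrite -[LHS]comp_idr -(assocVK X Y Z) comp_assoc -(comp_assoc _ _ (assoc X Y Z)).
by rewrite -assoc_nat comp_assoc assocK comp_idl.
Qed.

Lemma unitl_nat X X' (f : hom X X') : unitl X' ∘ (idm tunit ⊠ f) = f ∘ unitl X.
Proof. exact: tensm_unitl. Qed.

Lemma unitr_nat X X' (f : hom X X') : unitr X' ∘ (f ⊠ idm tunit) = f ∘ unitr X.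
Proof. exact: tensm_unitr. Qed.

Lemma tensm_cut X X' Y Y' (f : hom X X') (g : hom Y Y') :
  f ⊠ g = (f ⊠ idm Y') ∘ (idm X ⊠ g).
Proof. by rewrite -tensm_comp comp_idl comp_idr. Qed.

Lemma tensm_compl X Y Z V (f : hom Y Z) (g : hom X Y) :
  (f ∘ g) ⊠ idm V = (f ⊠ idm V) ∘ (g ⊠ idm V).
Proof. by rewrite -tensm_comp comp_idl. Qed.

Lemma tensm_compr X Y Z V (f : hom Y Z) (g : hom X Y) :
  idm V ⊠ (f ∘ g) = (idm V ⊠ f) ∘ (idm V ⊠ g).
Proof. by rewrite -tensm_comp comp_idl. Qed.

(** Taking [V] to be the unit suffices. The purpose is to prove identities between bare braidings:
    with a spare factor on the right every braiding becomes a [swap], to which the rewriting rules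
    below apply. *)
Lemma tensm_faithful X Y (f g : hom X Y) : (forall V, f ⊠ idm V = g ⊠ idm V) -> f = g.
Proof.
move=> /(_ tunit) e.
rewrite -[f]comp_idr -[g]comp_idr -(unitrVK X) !comp_assoc -!unitr_nat.
by rewrite e.
Qed.

Lemma tens_tens_idl X Y Z W (f : hom Y Z) :
  (idm X ⊠ f) ⊠ idm W
  = eq_hom (eq_sym (tens_assoc X Z W)) ∘ (idm X ⊠ (f ⊠ idm W)) ∘ eq_hom (tens_assoc X Y W).
Proof. by rewrite -[eq_hom (eq_sym _)]/(assocV _ _ _) assocV_nat -comp_assoc assocK comp_idr. Qed.

Lemma id_tens_tens X Y Z W (f : hom Z W) :
  idm (X ⊗ Y) ⊠ f
  = eq_hom (eq_sym (tens_assoc X Y W)) ∘ (idm X ⊠ (idm Y ⊠ f)) ∘ eq_hom (tens_assoc X Y Z).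
Proof.
by rewrite -[eq_hom (eq_sym _)]/(assocV _ _ _) assocV_nat -comp_assoc assocK comp_idr tensm_id.
Qed.
End Strictness.

(** * Calculus of braidings between right-bracketed products *)

Section Braid.
Variable C : strict_braided_category.
Implicit Types X Y Z W V : C.

(* Opaque, as rewriting would otherwise find [∘] and [⊠] inside [swap]. *)
Fact swap_sig X Y W :
  {s : hom (X ⊗ (Y ⊗ W)) (Y ⊗ (X ⊗ W))
     | s = assoc Y X W ∘ (braid X Y ⊠ idm W) ∘ assocV X Y W}.
Proof. by eexists. Qed.

(** The braiding [c_{X,Y} ⊗ W] between right-bracketed products. *)
Definition swap X Y W : hom (X ⊗ (Y ⊗ W)) (Y ⊗ (X ⊗ W)) := proj1_sig (swap_sig X Y W).

Lemma swapE X Y W :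
  swap X Y W = assoc Y X W ∘ (braid X Y ⊠ idm W) ∘ assocV X Y W.
Proof. exact: proj2_sig (swap_sig X Y W). Qed.

Lemma swap_nat X X' Y Y' W W' (f : hom X X') (g : hom Y Y') (h : hom W W') :
  swap X' Y' W' ∘ (f ⊠ (g ⊠ h)) = (g ⊠ (f ⊠ h)) ∘ swap X Y W.
Proof.
rewrite !swapE -!comp_assoc assocV_nat (comp_assoc (braid _ _ ⊠ _)) -tensm_comp.
by rewrite braid_nat comp_idl -[h in LHS]comp_idr tensm_comp !comp_assoc assoc_nat.
Qed.

Lemma braid_tensE X Y V :
  braid X Y ⊠ idm V
  = eq_hom (eq_sym (tens_assoc Y X V)) ∘ swap X Y V ∘ eq_hom (tens_assoc X Y V).
Proof.
rewrite swapE /assoc /assocV !comp_assoc eq_hom_comp eq_hom_refl comp_idl.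
by rewrite -comp_assoc eq_hom_comp eq_hom_refl comp_idr.
Qed.

Lemma braid_midE X Y Z W :
  braid_mid X Y Z W
  = eq_hom (eq_sym (tens_assoc X Z (Y ⊗ W))) ∘ (idm X ⊠ swap Y Z W)
    ∘ eq_hom (tens_assoc X Y (Z ⊗ W)).
Proof. by rewrite /braid_mid swapE !tensm_compr !comp_assoc. Qed.

Lemma braid_mid_nat X X' Y Y' Z Z' W W'
    (f : hom X X') (g : hom Y Y') (h : hom Z Z') (k : hom W W') :
  braid_mid X' Y' Z' W' ∘ ((f ⊠ g) ⊠ (h ⊠ k))
  = ((f ⊠ h) ⊠ (g ⊠ k)) ∘ braid_mid X Y Z W.
Proof.
rewrite !braid_midE -!/(assoc _ _ _) -!/(assocV _ _ _) -!comp_assoc assoc_nat.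
rewrite (comp_assoc (idm _ ⊠ _)) -tensm_comp comp_idl swap_nat.
by rewrite -[f in LHS]comp_idr tensm_comp !comp_assoc assocV_nat.
Qed.

Ltac close := repeat first [reflexivity | apply: eq_hom_irr | apply: comp_congr].
Ltac push := rewrite ?tensm_compl ?tensm_compr ?tens_tens_idl ?braid_tensE
  ?tensm_compl ?tensm_compr ?eq_hom_tensr ?eq_hom_tensl.
Ltac merge := rewrite -?comp_assoc ?(eq_hom_compA, eq_hom_comp) ?eq_hom_refl
  ?tensm_id ?comp_idl ?comp_idr.

Lemma braid_tens_tensE X Y W V :
  (braid X Y ⊠ idm W) ⊠ idm V
  = eq_hom (eq_sym (tens_assoc (Y ⊗ X) W V)) ∘ (braid X Y ⊠ idm (W ⊗ V))
    ∘ eq_hom (tens_assoc (X ⊗ Y) W V).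
Proof.
by rewrite -tensm_id -[eq_hom (eq_sym _)]/(assocV _ _ _) assocV_nat -comp_assoc assocK comp_idr.
Qed.

Lemma swap_tens X Y W V :
  swap X Y W ⊠ idm V
  = eq_hom (eq_trans (f_equal (tens Y) (eq_sym (tens_assoc X W V)))
             (eq_sym (tens_assoc Y (X ⊗ W) V)))
    ∘ swap X Y (W ⊗ V)
    ∘ eq_hom (eq_trans (tens_assoc X (Y ⊗ W) V) (f_equal (tens X) (tens_assoc Y W V))).
Proof. by rewrite swapE /assoc /assocV !tensm_compl braid_tens_tensE; push; merge; close. Qed.

Lemma swap_tail X Y W W' (e : W = W') :
  swap X Y W = eq_hom (eq_sym (f_equal (fun U => Y ⊗ (X ⊗ U)) e)) ∘ swap X Y W'
               ∘ eq_hom (f_equal (fun U => X ⊗ (Y ⊗ U)) e).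
Proof. by destruct e; rewrite /= comp_idl comp_idr. Qed.

(** This and [swap_tensr] are the two hexagons, read as rules that split a crossing of a product
    into crossings of its factors. *)
Lemma swap_tensl X Y Z W :
  swap (X ⊗ Y) Z W
  = eq_hom (f_equal (tens Z) (eq_sym (tens_assoc X Y W)))
    ∘ swap X Z (Y ⊗ W) ∘ (idm X ⊠ swap Y Z W)
    ∘ eq_hom (tens_assoc X Y (Z ⊗ W)).
Proof.
rewrite swapE braid_tensl /assoc /assocV.
rewrite !tensm_compl braid_tens_tensE. push; merge.
by close.
Qed.

Lemma swap_tensr X Y Z W :
  swap X (Y ⊗ Z) W
  = eq_hom (eq_sym (tens_assoc Y Z (X ⊗ W)))
    ∘ (idm Y ⊠ swap X Z W) ∘ swap X Y (Z ⊗ W)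
    ∘ eq_hom (f_equal (tens X) (tens_assoc Y Z W)).
Proof.
rewrite swapE braid_tensr /assoc /assocV.
rewrite !tensm_compl braid_tens_tensE. push; merge.
by close.
Qed.

(* Rewrites a composite as one of swaps between right-bracketed products, with a
   single [eq_hom] at each end; by proof irrelevance [close] identifies these. *)
Ltac flat := rewrite ?tensm_compl ?tensm_compr ?tens_tens_idl ?id_tens_tens ?braid_tensE
  ?swap_tens ?swap_tensl ?swap_tensr ?tensm_compl ?tensm_compr ?eq_hom_tensr ?eq_hom_tensl;
  merge.

(** A crossing commutes with whatever happens on the strands to its right. After splitting by the
    hexagons this is the only braid relation that the next two lemmas require; [k] lets it be
    applied inside a longer composite. *)
Lemma swap_slide X Y W W' Z V (f : hom W W') (k : hom V (Z ⊗ (X ⊗ (Y ⊗ W)))) :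
  (idm Z ⊠ swap X Y W') ∘ ((idm Z ⊠ (idm X ⊠ (idm Y ⊠ f))) ∘ k)
  = (idm Z ⊠ (idm Y ⊠ (idm X ⊠ f))) ∘ ((idm Z ⊠ swap X Y W) ∘ k).
Proof. by rewrite !comp_assoc -!tensm_comp !comp_idl swap_nat. Qed.

(** The part of coassociativity of a tensor product of coalgebras that concerns the braiding alone;
    [braid_mid_merge] is its counterpart for associativity of a tensor product of algebras. *)
Lemma braid_mid_split X X' X'' Y Y' Y'' :
  assoc _ _ _ ∘ (braid_mid X X' Y Y' ⊠ idm (X'' ⊗ Y''))
    ∘ braid_mid (X ⊗ X') X'' (Y ⊗ Y') Y''
  = (idm (X ⊗ Y) ⊠ braid_mid X' X'' Y' Y'') ∘ braid_mid X (X' ⊗ X'') Y (Y' ⊗ Y'')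
    ∘ (assoc X X' X'' ⊠ assoc Y Y' Y'').
Proof.
rewrite (tensm_cut (assoc _ _ _)) /assoc !braid_midE. flat. flat.
rewrite swap_slide.
by close.
Qed.

Lemma braid_mid_merge X Y Z W X' Y' :
  braid_mid (X ⊗ Z) (Y ⊗ W) X' Y' ∘ (braid_mid X Y Z W ⊠ idm (X' ⊗ Y'))
  = (assocV X Z X' ⊠ assocV Y W Y') ∘ braid_mid X Y (Z ⊗ X') (W ⊗ Y')
    ∘ (idm (X ⊗ Y) ⊠ braid_mid Z W X' Y') ∘ assoc _ _ _.
Proof.
rewrite (tensm_cut (assocV _ _ _)) /assoc /assocV !braid_midE. flat. flat.
rewrite swap_slide.
by close.
Qed.

Lemma braid_tens_tens X Y Z W :
  braid (X ⊗ Y) (Z ⊗ W)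
  = braid_mid Z X W Y ∘ (braid X Z ⊠ braid Y W) ∘ braid_mid X Y Z W.
Proof.
apply: tensm_faithful => V.
rewrite (tensm_cut (braid X Z)) !braid_midE. flat. flat. flat.
(* The sides now differ only in how the strands to the right of the crossing of [X] and [Z] are
   bracketed. *)
rewrite (swap_tail X Z (tens_assoc W Y V)); merge.
by close.
Qed.

Lemma braid_eqr X Y Y' (e : Y = Y') :
  braid X Y = eq_hom (eq_sym (f_equal (fun U => U ⊗ X) e)) ∘ braid X Y'
              ∘ eq_hom (f_equal (tens X) e).
Proof. by destruct e; rewrite /= comp_idl comp_idr. Qed.

Lemma braid_eql X Y Y' (e : Y = Y') :
  braid Y X = eq_hom (eq_sym (f_equal (tens X) e)) ∘ braid Y' X
              ∘ eq_hom (f_equal (fun U => U ⊗ X) e).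
Proof. by destruct e; rewrite /= comp_idl comp_idr. Qed.

Lemma unitl_tens X Y (f : hom X Y) :
  idm tunit ⊠ f = eq_hom (eq_sym (tens_unitl Y)) ∘ f ∘ eq_hom (tens_unitl X).
Proof.
by rewrite -comp_assoc -/(unitl X) -unitl_nat comp_assoc eq_hom_comp eq_hom_refl comp_idl.
Qed.

Lemma unitr_tens X Y (f : hom X Y) :
  f ⊠ idm tunit = eq_hom (eq_sym (tens_unitr Y)) ∘ f ∘ eq_hom (tens_unitr X).
Proof.
by rewrite -comp_assoc -/(unitr X) -unitr_nat comp_assoc eq_hom_comp eq_hom_refl comp_idl.
Qed.

(* The hexagons make the braidings with [tunit] idempotent, up to identities. *)
Lemma eq_hom_idem X Y Z W (b : hom X Y) (bV : hom Y X) (e0 : Y = W) (e1 e3 : Z = X)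
    (e2 : Y = X) (e4 : Y = W) :
  bV ∘ b = idm X ->
  eq_hom e0 ∘ (b ∘ eq_hom e1) = eq_hom e4 ∘ (b ∘ (eq_hom e2 ∘ (b ∘ eq_hom e3))) ->
  b = eq_hom (eq_sym e2).
Proof.
move=> bK; rewrite (eq_hom_irr e4 e0) (eq_hom_irr e3 e1) => /(f_equal (comp (eq_hom (eq_sym e0)))).
rewrite !eq_hom_compA eq_hom_refl !comp_idl => /(f_equal (comp bV)).
rewrite !comp_assoc bK comp_idl -2!comp_assoc => /(f_equal (fun f => f ∘ eq_hom (eq_sym e1))).
rewrite -!comp_assoc eq_hom_comp eq_hom_refl comp_idr.
move=> /(f_equal (comp (eq_hom (eq_sym e2)))); rewrite comp_idr => ->.
by rewrite comp_idl eq_hom_compA eq_hom_refl comp_idl.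
Qed.

Lemma braid_unitr X : braid X tunit = unitlV X ∘ unitr X.
Proof.
rewrite /unitr /unitlV eq_hom_comp.
have h := braid_tensr X tunit tunit.
rewrite (braid_eqr _ (tens_unitl tunit)) unitl_tens unitr_tens /assoc /assocV in h.
rewrite -!comp_assoc !(eq_hom_compA, eq_hom_comp) in h.
by rewrite (eq_hom_idem (braidK _ _) h); exact: eq_hom_irr.
Qed.

Lemma braid_unitl X : braid tunit X = unitrV X ∘ unitl X.
Proof.
rewrite /unitl /unitrV eq_hom_comp.
have h := braid_tensl tunit tunit X.
rewrite (braid_eql _ (tens_unitl tunit)) unitl_tens unitr_tens /assoc /assocV in h.
rewrite -!comp_assoc !(eq_hom_compA, eq_hom_comp) in h.
by rewrite (eq_hom_idem (braidK _ _) h); exact: eq_hom_irr.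
Qed.
End Braid.

(** * Pairings and tensor coalgebras *)

(** It plays the role of the pairing into a cartesian product, with the coproduct of [T] as the
    diagonal. The targets are bare objects, so that every intermediate stage of a composite can be
    evaluated on it. *)
Definition pairing (C : strict_braided_category) (T : coalgebra C) (U V : C)
    (f : hom T U) (g : hom T V) : hom T (U ⊗ V) :=
  (f ⊠ g) ∘ comul T.

Notation "⟨ f , g ⟩" := (pairing f g) (at level 0, format "⟨ f ,  g ⟩").

Section Pairing.
Variables (C : strict_braided_category) (T : coalgebra C).
Implicit Types U V W : C.

Lemma tensm_pair U U' V V' (h : hom U U') (k : hom V V') (f : hom T U) (g : hom T V) :
  (h ⊠ k) ∘ ⟨f, g⟩ = ⟨h ∘ f, k ∘ g⟩.
Proof. by rewrite /pairing comp_assoc tensm_comp. Qed.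

Lemma pair_comp (S : coalgebra C) U V (f : hom T U) (g : hom T V) (t : hom S T) :
  is_coalgebra_morphism S T t -> ⟨f, g⟩ ∘ t = ⟨f ∘ t, g ∘ t⟩.
Proof. by case=> _ e; rewrite /pairing -comp_assoc e comp_assoc tensm_comp. Qed.

Lemma comul_pair (S : coalgebra C) (t : hom T S) :
  is_coalgebra_morphism T S t -> comul S ∘ t = ⟨t, t⟩.
Proof. by case=> _ ->. Qed.

Lemma pair_id : ⟨idm T, idm T⟩ = comul T.
Proof. by rewrite /pairing tensm_id comp_idl. Qed.

Lemma assoc_pair U V W (f : hom T U) (g : hom T V) (h : hom T W) :
  assoc U V W ∘ ⟨⟨f, g⟩, h⟩ = ⟨f, ⟨g, h⟩⟩.
Proof.
rewrite -[f]comp_idr -[g]comp_idr -[h]comp_idr -!tensm_pair comp_assoc assoc_nat.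
rewrite -comp_assoc; congr (_ ∘ _).
rewrite pair_id /pairing comp_assoc.
exact: comul_assoc (coalg_laws T).
Qed.

Lemma assocV_pair U V W (f : hom T U) (g : hom T V) (h : hom T W) :
  assocV U V W ∘ ⟨f, ⟨g, h⟩⟩ = ⟨⟨f, g⟩, h⟩.
Proof. by rewrite -assoc_pair comp_assoc assocK comp_idl. Qed.

Lemma unitl_pair U (f : hom T U) : unitl U ∘ ⟨counit T, f⟩ = f.
Proof.
rewrite -[f in LHS]comp_idr -[counit T]comp_idl -tensm_pair comp_assoc unitl_nat -comp_assoc.
by rewrite /pairing (comul_unitl (coalg_laws T)) unitlVK comp_idr.
Qed.

Lemma unitr_pair U (f : hom T U) : unitr U ∘ ⟨f, counit T⟩ = f.
Proof.
rewrite -[f in LHS]comp_idr -[counit T]comp_idl -tensm_pair comp_assoc unitr_nat -comp_assoc.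
by rewrite /pairing (comul_unitr (coalg_laws T)) unitrVK comp_idr.
Qed.

Lemma unitlV_pair U (f : hom T U) : ⟨counit T, f⟩ = unitlV U ∘ f.
Proof. by rewrite -[f in RHS]unitl_pair comp_assoc unitlK comp_idl. Qed.

Lemma unitrV_pair U (f : hom T U) : ⟨f, counit T⟩ = unitrV U ∘ f.
Proof. by rewrite -[f in RHS]unitr_pair comp_assoc unitrK comp_idl. Qed.

Hypothesis cocT : braid T T ∘ comul T = comul T.

(** By naturality the braiding moves onto the coproduct of [T], which absorbs it. On points the
    braiding is thus the plain exchange of components, and so is its inverse. *)
Lemma braid_pair U V (f : hom T U) (g : hom T V) : braid U V ∘ ⟨f, g⟩ = ⟨g, f⟩.
Proof. by rewrite /pairing comp_assoc braid_nat -comp_assoc cocT. Qed.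

Lemma braidV_pair U V (f : hom T U) (g : hom T V) : braidV U V ∘ ⟨g, f⟩ = ⟨f, g⟩.
Proof. by rewrite -braid_pair comp_assoc braidK comp_idl. Qed.

Lemma braid_mid_pair U U' V V' (f : hom T U) (f' : hom T U') (g : hom T V) (g' : hom T V') :
  braid_mid U U' V V' ∘ ⟨⟨f, f'⟩, ⟨g, g'⟩⟩ = ⟨⟨f, g⟩, ⟨f', g'⟩⟩.
Proof.
rewrite /braid_mid -!comp_assoc assoc_pair !tensm_pair !comp_idl.
by rewrite assocV_pair tensm_pair braid_pair assoc_pair comp_idl assocV_pair.
Qed.

Lemma pair_coalg (X Y : coalgebra C) (f : hom T X) (g : hom T Y) :
  is_coalgebra_morphism T X f -> is_coalgebra_morphism T Y g ->
  is_coalgebra_morphism T (tens_coalgebra X Y) ⟨f, g⟩.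
Proof.
move=> hf hg; split; rewrite /= -comp_assoc tensm_pair.
  by rewrite (proj1 hf) (proj1 hg) unitl_pair.
by rewrite !comul_pair // braid_mid_pair.
Qed.

End Pairing.

Section TensorCoalgebra.
Variables (C : strict_braided_category) (X Y : coalgebra C).

Lemma swap_unitr (Z W : C) :
  swap Z tunit W = eq_hom (eq_trans (f_equal (tens Z) (tens_unitl W))
             (eq_sym (tens_unitl (Z ⊗ W)))).
Proof.
rewrite swapE braid_unitr /assoc /assocV /unitr /unitlV !(eq_hom_comp, eq_hom_tensl).
exact: eq_hom_irr.
Qed.

Lemma swap_unitl (Z W : C) :
  swap tunit Z W = eq_hom (eq_trans (tens_unitl (Z ⊗ W))
             (eq_sym (f_equal (tens Z) (tens_unitl W)))).
Proof.
rewrite swapE braid_unitl /assoc /assocV /unitl /unitrV !(eq_hom_comp, eq_hom_tensl).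
exact: eq_hom_irr.
Qed.

Lemma braid_mid_unitm (Z W : C) :
  braid_mid Z tunit tunit W
  = idm _.
Proof.
rewrite braid_midE swap_unitr !(eq_hom_comp, eq_hom_tensr).
exact: eq_hom_refl.
Qed.

Lemma braid_mid_unitl (Z W : C) :
  (unitl tunit ⊠ idm (Z ⊗ W)) ∘ braid_mid tunit Z tunit W = unitlV (Z ⊗ W) ∘ (unitl Z ⊠ unitl W).
Proof.
rewrite braid_midE swap_unitr (tensm_cut (unitl Z)) /unitl /unitlV.
rewrite !(eq_hom_comp, eq_hom_tensr, eq_hom_tensl).
exact: eq_hom_irr.
Qed.

Lemma braid_mid_unitr (Z W : C) :
  (idm (Z ⊗ W) ⊠ unitl tunit) ∘ braid_mid Z tunit W tunit = unitrV (Z ⊗ W) ∘ (unitr Z ⊠ unitr W).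
Proof.
rewrite braid_midE swap_unitl (tensm_cut (unitr Z)) /unitr /unitl /unitrV.
rewrite !(eq_hom_comp, eq_hom_tensr, eq_hom_tensl).
exact: eq_hom_irr.
Qed.

Lemma tens_coalgebra_laws : is_coalgebra (tens_coalgebra X Y).
Proof.
have [lX rX aX] := coalg_laws X; have [lY rY aY] := coalg_laws Y.
split=> /=.
- have e : ((counit X ⊠ counit Y) ⊠ idm (X ⊗ Y)) ∘ braid_mid X X Y Y
      = braid_mid _ _ _ _ ∘ ((counit X ⊠ idm X) ⊠ (counit Y ⊠ idm Y)).
    by rewrite braid_mid_nat tensm_id.
  rewrite tensm_compl -comp_assoc (comp_assoc _ (braid_mid _ _ _ _)) e.
  rewrite -(comp_assoc (braid_mid _ _ _ _)) -tensm_comp lX lY comp_assoc braid_mid_unitl.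
  by rewrite -comp_assoc -tensm_comp !unitlVK tensm_id comp_idr.
- have e : (idm (X ⊗ Y) ⊠ (counit X ⊠ counit Y)) ∘ braid_mid X X Y Y
      = braid_mid _ _ _ _ ∘ ((idm X ⊠ counit X) ⊠ (idm Y ⊠ counit Y)).
    by rewrite braid_mid_nat tensm_id.
  rewrite tensm_compr -comp_assoc (comp_assoc _ (braid_mid _ _ _ _)) e.
  rewrite -(comp_assoc (braid_mid _ _ _ _)) -tensm_comp rX rY comp_assoc braid_mid_unitr.
  by rewrite -comp_assoc -tensm_comp !unitrVK tensm_id comp_idr.
- have el : ((comul X ⊠ comul Y) ⊠ idm (X ⊗ Y)) ∘ braid_mid X X Y Y
      = braid_mid _ _ _ _ ∘ ((comul X ⊠ idm X) ⊠ (comul Y ⊠ idm Y)).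
    by rewrite braid_mid_nat tensm_id.
  have er : (idm (X ⊗ Y) ⊠ (comul X ⊠ comul Y)) ∘ braid_mid X X Y Y
      = braid_mid _ _ _ _ ∘ ((idm X ⊠ comul X) ⊠ (idm Y ⊠ comul Y)).
    by rewrite braid_mid_nat tensm_id.
  have spl := braid_mid_split X X X Y Y Y.
  move: el er spl; rewrite tensm_compl tensm_compr.
  (* [braid_mid] is itself a composite; as a variable it stays whole under the reassociations that
     follow. *)
  move: (braid_mid X X Y Y) (braid_mid _ _ (Y ⊗ Y) _) (braid_mid _ (X ⊗ X) _ _)
    => b b1 b2 el er spl.
  rewrite -!comp_assoc (comp_assoc _ b) el (comp_assoc _ b) er -!comp_assoc -!tensm_comp -aX -aY.
  by rewrite !tensm_comp !comp_assoc spl.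
Qed.

Lemma braid_mid_invol (Z Z' W W' : C) :
  braid W Z' ∘ braid Z' W = idm _ ->
  braid_mid Z W Z' W' ∘ braid_mid Z Z' W W' = idm _.
Proof.
move=> e; rewrite !braid_midE -!comp_assoc eq_hom_compA eq_hom_refl comp_idl.
rewrite (comp_assoc (_ ⊠ swap _ _ _)) -tensm_comp comp_idl.
have -> : swap W Z' W' ∘ swap Z' W W' = idm _.
  rewrite !swapE -!comp_assoc (comp_assoc (assocV _ _ _)) assocK comp_idl.
  by rewrite (comp_assoc (braid _ _ ⊠ _)) -tensm_comp e comp_idl tensm_id comp_idl assocVK.
by rewrite tensm_id comp_idl eq_hom_comp eq_hom_refl.
Qed.

(** By [braid_tens_tens] the braiding begins with the middle crossing of [Y] over [X], which meets
    the crossing of [X] over [Y] that ends the coproduct. The hypothesis on the double braiding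
    cancels the two, and cocommutativity of each factor does the rest. *)
Lemma tens_cocommutative :
  braid X X ∘ comul X = comul X -> braid Y Y ∘ comul Y = comul Y ->
  braid Y X ∘ braid X Y = idm _ ->
  braid (X ⊗ Y) (X ⊗ Y) ∘ comul (tens_coalgebra X Y) = comul (tens_coalgebra X Y).
Proof.
move=> cX cY sXY; rewrite /= braid_tens_tens comp_assoc.
rewrite -(comp_assoc _ (braid_mid X Y X Y)) braid_mid_invol // comp_idr.
by rewrite -comp_assoc -tensm_comp cX cY.
Qed.

Definition tensC : coalgebra C := Coalgebra tens_coalgebra_laws.
End TensorCoalgebra.

(** * Cancellation in convolution actions and Schauenburg's theorem *)

Section ConvolutionCancellation.
Variables (C : strict_braided_category) (X : coalgebra C) (H : hopf_on X) (M N : C).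

(* [act a k] is the action of the convolution algebra [hom X X] on [hom N M], for a
   module [M] and a comodule [N]; [act (idm X)] is invertible, with inverse [act (antip H)]. *)
Lemma convolution_cancel_l (act : hom (X ⊗ M) M) (coact : hom N (X ⊗ N)) (k k' : hom N M) :
  act ∘ (idm X ⊠ act) = act ∘ (mu H ⊠ idm M) ∘ assocV X X M ->
  act ∘ (eta H ⊠ idm M) = unitl M ->
  (idm X ⊠ coact) ∘ coact = assoc X X N ∘ (comul X ⊠ idm N) ∘ coact ->
  (counit X ⊠ idm N) ∘ coact = unitlV N ->
  act ∘ (idm X ⊠ k) ∘ coact = act ∘ (idm X ⊠ k') ∘ coact -> k = k'.
Proof.
move=> actA act1 coactA coact1.
pose conv (a : hom X X) (h : hom N M) := act ∘ (a ⊠ h) ∘ coact.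
have convM a b h : conv a (conv b h) = conv (mu H ∘ (a ⊠ b) ∘ comul X) h.
  have split : a ⊠ conv b h = (idm X ⊠ act) ∘ (a ⊠ (b ⊠ h)) ∘ (idm X ⊠ coact).
    by rewrite -!tensm_comp comp_idl comp_idr.
  rewrite /conv -/(conv b h) split !comp_assoc actA -!comp_assoc coactA -!comp_assoc.
  rewrite (comp_assoc (assocV _ _ _)) assocV_nat -!comp_assoc.
  rewrite (comp_assoc (assocV _ _ _)) assocK comp_idl.
  have eh : h = idm M ∘ (h ∘ idm N) by rewrite comp_idl comp_idr.
  by rewrite {2}eh !tensm_comp !comp_assoc.
have conv1 h : conv (eta H ∘ counit X) h = h.
  have -> : conv (eta H ∘ counit X) h
      = act ∘ (eta H ⊠ idm M) ∘ (idm tunit ⊠ h) ∘ ((counit X ⊠ idm N) ∘ coact).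
    have eh : h = idm M ∘ (h ∘ idm N) by rewrite comp_idl comp_idr.
    rewrite /conv {1}eh -[counit X in LHS]comp_idl !tensm_comp.
    by rewrite -!comp_assoc.
  by rewrite act1 coact1 unitl_nat -comp_assoc unitlVK comp_idr.
rewrite -/(conv _ k) -/(conv _ k') => /(f_equal (conv (antip H))).
by rewrite !convM antipl !conv1.
Qed.

Lemma convolution_cancel_r (act : hom (M ⊗ X) M) (coact : hom N (N ⊗ X)) (k k' : hom N M) :
  act ∘ (act ⊠ idm X) = act ∘ (idm M ⊠ mu H) ∘ assoc M X X ->
  act ∘ (idm M ⊠ eta H) = unitr M ->
  (coact ⊠ idm X) ∘ coact = assocV N X X ∘ (idm N ⊠ comul X) ∘ coact ->
  (idm N ⊠ counit X) ∘ coact = unitrV N ->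
  act ∘ (k ⊠ idm X) ∘ coact = act ∘ (k' ⊠ idm X) ∘ coact -> k = k'.
Proof.
move=> actA act1 coactA coact1.
pose conv (a : hom X X) (h : hom N M) := act ∘ (h ⊠ a) ∘ coact.
have convM a b h : conv a (conv b h) = conv (mu H ∘ (b ⊠ a) ∘ comul X) h.
  have split : conv b h ⊠ a = (act ⊠ idm X) ∘ ((h ⊠ b) ⊠ a) ∘ (coact ⊠ idm X).
    by rewrite -!tensm_comp comp_idl comp_idr.
  rewrite /conv -/(conv b h) split !comp_assoc actA -!comp_assoc coactA -!comp_assoc.
  rewrite (comp_assoc (assoc _ _ _)) assoc_nat -!comp_assoc.
  rewrite (comp_assoc (assoc _ _ _)) assocVK comp_idl.
  have eh : h = idm M ∘ (h ∘ idm N) by rewrite comp_idl comp_idr.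
  by rewrite {2}eh !tensm_comp !comp_assoc.
have conv1 h : conv (eta H ∘ counit X) h = h.
  have -> : conv (eta H ∘ counit X) h
      = act ∘ (idm M ⊠ eta H) ∘ (h ⊠ idm tunit) ∘ ((idm N ⊠ counit X) ∘ coact).
    have eh : h = idm M ∘ (h ∘ idm N) by rewrite comp_idl comp_idr.
    rewrite /conv {1}eh -[counit X in LHS]comp_idl !tensm_comp.
    by rewrite -!comp_assoc.
  by rewrite act1 coact1 unitr_nat -comp_assoc unitrVK comp_idr.
rewrite -/(conv _ k) -/(conv _ k') => /(f_equal (conv (antip H))).
by rewrite !convM antipr !conv1.
Qed.
End ConvolutionCancellation.

Section Schauenburg.
Variables (C : strict_braided_category) (X : coalgebra C) (H : hopf_on X).

Lemma mu_assocV : mu H ∘ (idm X ⊠ mu H) = mu H ∘ (mu H ⊠ idm X) ∘ assocV X X X.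
Proof. by rewrite mu_assoc -comp_assoc assocVK comp_idr. Qed.

(** This and the next three lemmas supply the free modules and cofree comodules to which the
    cancellation lemmas are applied. *)
Lemma free_module_l (W : C) :
  let act := (mu H ⊠ idm W) ∘ assocV X X W in
  act ∘ (idm X ⊠ act) = act ∘ (mu H ⊠ idm (X ⊗ W)) ∘ assocV X X (X ⊗ W) /\
  act ∘ (eta H ⊠ idm _) = unitl _.
Proof.
rewrite /= tensm_compr -(tensm_id X W); split.
- rewrite -!comp_assoc !(comp_assoc (assocV _ _ _) (_ ⊠ (_ ⊠ _))) !assocV_nat.
  rewrite -!comp_assoc !(comp_assoc (_ ⊠ idm W)) -!tensm_comp !comp_idl mu_assocV.
  rewrite [in LHS]tensm_compl -!comp_assoc /assocV !(eq_hom_tensr, eq_hom_tensl, eq_hom_comp).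
  by congr (_ ∘ _); exact: eq_hom_irr.
- rewrite -comp_assoc assocV_nat comp_assoc -tensm_comp mu_unitl comp_idl.
  by rewrite /unitl /assocV eq_hom_tensl eq_hom_comp; exact: eq_hom_irr.
Qed.

Lemma free_module_r (W : C) :
  let act := (idm W ⊠ mu H) ∘ assoc W X X in
  act ∘ (act ⊠ idm X) = act ∘ (idm (W ⊗ X) ⊠ mu H) ∘ assoc (W ⊗ X) X X /\
  act ∘ (idm _ ⊠ eta H) = unitr _.
Proof.
rewrite /= tensm_compl -(tensm_id W X); split.
- rewrite -!comp_assoc !(comp_assoc (assoc _ _ _) ((_ ⊠ _) ⊠ _)) !assoc_nat.
  rewrite -!comp_assoc !(comp_assoc (idm W ⊠ _)) -!tensm_comp !comp_idl mu_assoc.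
  rewrite [in LHS]tensm_compr -!comp_assoc /assoc !(eq_hom_tensr, eq_hom_tensl, eq_hom_comp).
  by congr (_ ∘ _); exact: eq_hom_irr.
- rewrite -comp_assoc assoc_nat comp_assoc -tensm_comp mu_unitr comp_idl.
  by rewrite /unitr /assoc eq_hom_tensr eq_hom_comp; exact: eq_hom_irr.
Qed.

Lemma comul_assocV :
  (comul X ⊠ idm X) ∘ comul X = assocV X X X ∘ (idm X ⊠ comul X) ∘ comul X.
Proof.
by rewrite -comp_assoc -(comul_assoc (coalg_laws X)) !comp_assoc assocK comp_idl.
Qed.

Lemma cofree_comodule_l (W : C) :
  let coact := assoc X X W ∘ (comul X ⊠ idm W) in
  (idm X ⊠ coact) ∘ coact = assoc X X _ ∘ (comul X ⊠ idm _) ∘ coact /\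
  (counit X ⊠ idm _) ∘ coact = unitlV _.
Proof.
rewrite /= tensm_compr -(tensm_id X W); split.
- rewrite -!comp_assoc !(comp_assoc (_ ⊠ (_ ⊠ _)) (assoc _ _ _)) -!assoc_nat.
  rewrite -!comp_assoc -!tensm_comp !comp_idl comul_assocV.
  rewrite -!comp_assoc [in RHS]tensm_compl !comp_assoc /assoc /assocV.
  rewrite !(eq_hom_tensr, eq_hom_tensl, eq_hom_comp).
  by congr (_ ∘ _); exact: eq_hom_irr.
- rewrite comp_assoc -assoc_nat -comp_assoc -tensm_comp (comul_unitl (coalg_laws X)) comp_idl.
  by rewrite /unitlV /assoc eq_hom_tensl eq_hom_comp; exact: eq_hom_irr.
Qed.

Lemma cofree_comodule_r (W : C) :
  let coact := assocV W X X ∘ (idm W ⊠ comul X) in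
  (coact ⊠ idm X) ∘ coact = assocV _ X X ∘ (idm _ ⊠ comul X) ∘ coact /\
  (idm _ ⊠ counit X) ∘ coact = unitrV _.
Proof.
rewrite /= tensm_compl -(tensm_id W X); split.
- rewrite -!comp_assoc !(comp_assoc ((_ ⊠ _) ⊠ _) (assocV _ _ _)) -!assocV_nat.
  rewrite -!comp_assoc -!tensm_comp !comp_idl -(comul_assoc (coalg_laws X)).
  rewrite -!comp_assoc [in RHS]tensm_compr !comp_assoc /assoc /assocV.
  rewrite !(eq_hom_tensr, eq_hom_tensl, eq_hom_comp).
  by congr (_ ∘ _); exact: eq_hom_irr.
- rewrite comp_assoc -assocV_nat -comp_assoc -tensm_comp (comul_unitr (coalg_laws X)) comp_idl.
  by rewrite /unitrV /assocV eq_hom_tensr eq_hom_comp; exact: eq_hom_irr.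
Qed.

(** Like [braid_mid], but with an arbitrary morphism in the middle, so that the braiding can be
    compared with its inverse. *)
Definition mid (Y Z W V : C) (h : hom (Y ⊗ Z) (Z ⊗ Y))
    : hom ((W ⊗ Y) ⊗ (Z ⊗ V)) ((W ⊗ Z) ⊗ (Y ⊗ V)) :=
  assocV W Z (Y ⊗ V) ∘ (idm W ⊠ (assoc Z Y V ∘ (h ⊠ idm V) ∘ assocV Y Z V))
  ∘ assoc W Y (Z ⊗ V).

Lemma mid_braid Y Z W V : mid W V (braid Y Z) = braid_mid W Y Z V.
Proof. by rewrite /braid_mid /mid !tensm_compr !comp_assoc. Qed.

Lemma mid_comp Y Z W V (h : hom (Y ⊗ Z) (Z ⊗ Y)) (h' : hom (Z ⊗ Y) (Y ⊗ Z)) :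
  h ∘ h' = idm _ -> mid W V h ∘ mid W V h' = idm _.
Proof.
move=> e; rewrite /mid -!comp_assoc (comp_assoc (assoc _ _ _) (assocV _ _ _)) assocVK comp_idl.
rewrite (comp_assoc (idm W ⊠ _)) -tensm_comp comp_idl -!comp_assoc.
rewrite (comp_assoc (assocV _ _ _) (assoc _ _ _)) assocK comp_idl.
rewrite (comp_assoc (_ ⊠ _) (_ ⊠ _)) -tensm_comp e comp_idl !tensm_id comp_idl.
by rewrite assocVK tensm_id comp_idl assocK.
Qed.

(** The left leg is the convolution action of [idm X] on the free left module [X ⊗ X], the right leg
    that on the free right module; [midE] nests one in the other. Both are injective because the
    antipode is a convolution inverse of [idm X]. *)
Lemma mid_cancel (k k' : hom (X ⊗ X) (X ⊗ X)) :
  (mu H ⊠ mu H) ∘ mid X X k ∘ (comul X ⊠ comul X)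
  = (mu H ⊠ mu H) ∘ mid X X k' ∘ (comul X ⊠ comul X) -> k = k'.
Proof.
have [ml1 ml2] := free_module_l X; have [mr1 mr2] := free_module_r X.
have [cl1 cl2] := cofree_comodule_l X; have [cr1 cr2] := cofree_comodule_r X.
have midE h : (mu H ⊠ mu H) ∘ mid X X h ∘ (comul X ⊠ comul X) = (mu H ⊠ idm X) ∘ assocV X X X
    ∘ (idm X ⊠ ((idm X ⊠ mu H) ∘ assoc X X X ∘ (h ⊠ idm X) ∘ (assocV X X X ∘ (idm X ⊠ comul X))))
    ∘ (assoc X X X ∘ (comul X ⊠ idm X)).
  rewrite /mid; set K := assoc X X X ∘ _ ∘ _.
  have -> : (idm X ⊠ mu H) ∘ assoc X X X ∘ (h ⊠ idm X) ∘ (assocV X X X ∘ (idm X ⊠ comul X))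
      = (idm X ⊠ mu H) ∘ K ∘ (idm X ⊠ comul X) by rewrite /K !comp_assoc.
  have -> : comul X ⊠ comul X = ((idm X ⊠ idm X) ⊠ comul X) ∘ (comul X ⊠ idm X).
    by rewrite -tensm_comp tensm_id comp_idl comp_idr.
  have -> : mu H ⊠ mu H = (mu H ⊠ idm X) ∘ ((idm X ⊠ idm X) ⊠ mu H).
    by rewrite -tensm_comp tensm_id comp_idl comp_idr.
  rewrite !tensm_compr -!comp_assoc (comp_assoc (assoc X X (X ⊗ X))) assoc_nat.
  by rewrite (comp_assoc (_ ⊠ mu H)) -assocV_nat -!comp_assoc.
rewrite !midE => /(convolution_cancel_l ml1 ml2 cl1 cl2).
exact: (convolution_cancel_r mr1 mr2 cr1 cr2).
Qed.

Hypothesis cocX : braid X X ∘ comul X = comul X.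

(** Schauenburg's theorem. *)
Theorem braid_invol : braid X X ∘ braid X X = idm (X ⊗ X).
Proof.
(* Write [c] for the braiding. The coproduct is multiplicative: [comul ∘ mu = (mu ⊠ mu) ∘ mid c ∘
   (comul ⊠ comul)]. Composing with the inverse of [c], which fixes [comul], and sliding it past
   [mu ⊠ mu] gives the same formula with the inverse of [c] in the middle; [mid_cancel] then
   identifies the two. *)
suff {2}-> : braid X X = braidV X X by rewrite braidVK.
apply: mid_cancel.
have e := proj2 (mu_coalg H); rewrite /= -mid_braid in e.
have eV : braidV X X ∘ comul X = comul X by rewrite -{1}cocX comp_assoc braidK comp_idl.
have nat : braidV X X ∘ (mu H ⊠ mu H) = (mu H ⊠ mu H) ∘ braidV _ _.
  rewrite -[RHS]comp_idl -(braidK X X) -comp_assoc (comp_assoc (braid X X)) braid_nat.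
  by rewrite -(comp_assoc _ (braid _ _)) braidVK comp_idr.
(* The braiding of [X ⊗ X] with itself is [mid c], then [c ⊠ c], then [mid c]. The first factor
   cancels against the inverse crossing, and [c ⊠ c] is absorbed by the coproducts. *)
have flip : mid X X (braid X X) ∘ (comul X ⊠ comul X)
    = braid _ _ ∘ (mid X X (braidV X X) ∘ (comul X ⊠ comul X)).
  rewrite braid_tens_tens -mid_braid -(comp_assoc _ (mid _ _ _)).
  rewrite (comp_assoc (mid _ _ _) (mid _ _ _)).
  by rewrite mid_comp ?braidVK // comp_idl -comp_assoc -tensm_comp cocX.
rewrite -(comp_assoc _ _ (_ ⊠ _)) -e -{1}eV -comp_assoc e comp_assoc nat -comp_assoc flip.
by rewrite (comp_assoc (braidV _ _)) braidK comp_idl comp_assoc.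
Qed.

Lemma antipl_pair : mu H ∘ ⟨antip H, idm X⟩ = eta H ∘ counit X.
Proof. by rewrite /pairing comp_assoc antipl. Qed.

Lemma antipr_pair : mu H ∘ ⟨idm X, antip H⟩ = eta H ∘ counit X.
Proof. by rewrite /pairing comp_assoc antipr. Qed.

Lemma antip_counit : counit X ∘ antip H = counit X.
Proof.
have e : counit X ∘ mu H = unitl tunit ∘ (counit X ⊠ counit X) := proj1 (mu_coalg H).
have := antipr H => /(f_equal (comp (counit X))).
rewrite !comp_assoc (proj1 (eta_coalg H)) comp_idl e -!comp_assoc -/(pairing _ _) tensm_pair.
by rewrite comp_idr unitl_pair.
Qed.

Let prod := (mu H ⊠ mu H) ∘ braid_mid X X X X.

Lemma tens_mu_assoc : prod ∘ (prod ⊠ idm (X ⊗ X)) = prod ∘ (idm (X ⊗ X) ⊠ prod) ∘ assoc _ _ _.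
Proof.
have el : braid_mid X X X X ∘ ((mu H ⊠ mu H) ⊠ idm (X ⊗ X))
    = ((mu H ⊠ idm X) ⊠ (mu H ⊠ idm X)) ∘ braid_mid _ _ _ _.
  by rewrite -braid_mid_nat tensm_id.
have er : braid_mid X X X X ∘ (idm (X ⊗ X) ⊠ (mu H ⊠ mu H))
    = ((idm X ⊠ mu H) ⊠ (idm X ⊠ mu H)) ∘ braid_mid _ _ _ _.
  by rewrite -braid_mid_nat tensm_id.
have := braid_mid_merge X X X X X X; rewrite /prod tensm_compl tensm_compr.
move: el er; move: (braid_mid X X (X ⊗ X) (X ⊗ X)) (braid_mid (X ⊗ X) (X ⊗ X) X X)
  (braid_mid X X X X) => b2 b1 b el er mrg.
rewrite -!comp_assoc (comp_assoc b) el (comp_assoc b) er -!comp_assoc mrg !comp_assoc -!tensm_comp.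
by rewrite mu_assocV.
Qed.

Lemma tens_mu_unitl : prod ∘ ((eta H ⊠ eta H) ⊠ idm (X ⊗ X)) = unitl _ ∘ (unitl tunit ⊠ idm _).
Proof.
rewrite /prod -comp_assoc -(tensm_id X X) braid_mid_nat comp_assoc -tensm_comp !mu_unitl.
rewrite braid_midE swap_unitl (tensm_cut (unitl X)) tensm_id /unitl.
rewrite !(eq_hom_tensr, eq_hom_tensl) !eq_hom_comp.
exact: eq_hom_irr.
Qed.

Lemma tens_mu_unitr : prod ∘ (idm (X ⊗ X) ⊠ (eta H ⊠ eta H)) = unitr _ ∘ (idm _ ⊠ unitl tunit).
Proof.
rewrite /prod -comp_assoc -(tensm_id X X) braid_mid_nat comp_assoc -tensm_comp !mu_unitr.
rewrite braid_midE swap_unitr (tensm_cut (unitr X)) tensm_id /unitl /unitr.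
rewrite !(eq_hom_tensr, eq_hom_tensl) !eq_hom_comp.
exact: eq_hom_irr.
Qed.

(* Both sides are convolution inverse to [comul X] in [hom X (X ⊗ X)]. *)
Lemma antip_coalg : is_coalgebra_morphism X X (antip H).
Proof.
split; first exact: antip_counit.
pose unit := ⟨eta H ∘ counit X, eta H ∘ counit X⟩.
have unitE : unit = (eta H ⊠ eta H) ∘ (unitlV _ ∘ counit X).
  by rewrite /unit -unitlV_pair tensm_pair.
have convA (a b c : hom X (X ⊗ X)) : prod ∘ ⟨prod ∘ ⟨a, b⟩, c⟩ = prod ∘ ⟨a, prod ∘ ⟨b, c⟩⟩.
  rewrite -[c in LHS]comp_idl -tensm_pair comp_assoc tens_mu_assoc -comp_assoc assoc_pair.
  by rewrite -comp_assoc tensm_pair comp_idl.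
have conv1l a : prod ∘ ⟨unit, a⟩ = a.
  rewrite unitE -[a in LHS]comp_idl -tensm_pair comp_assoc tens_mu_unitl -comp_assoc tensm_pair.
  by rewrite comp_assoc unitlVK !comp_idl unitl_pair.
have conv1r a : prod ∘ ⟨a, unit⟩ = a.
  rewrite unitE -[a in LHS]comp_idl -tensm_pair comp_assoc tens_mu_unitr -comp_assoc tensm_pair.
  by rewrite comp_assoc unitlVK !comp_idl unitr_pair.
have inv_l : prod ∘ ⟨comul X ∘ antip H, comul X⟩ = unit.
  have e : comul X ∘ mu H = prod ∘ (comul X ⊠ comul X).
    by rewrite /prod -comp_assoc; exact: proj2 (mu_coalg H).
  rewrite -[comul X in X in ⟨_, X⟩]comp_idr -tensm_pair comp_assoc -e -comp_assoc.
  rewrite antipl_pair comp_assoc (proj2 (eta_coalg H)).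
  by rewrite unitE comp_assoc.
(* Cocommutativity enters here: it lets the two middle components be exchanged, leaving the antipode
   law in each factor. *)
have inv_r : prod ∘ ⟨comul X, ⟨antip H, antip H⟩⟩ = unit.
  by rewrite -pair_id /prod -comp_assoc braid_mid_pair // tensm_pair antipr_pair.
by rewrite -[LHS]conv1r -inv_r -convA inv_l conv1l.
Qed.

End Schauenburg.

(** * Skew braces, actions and matched pairs of groups *)

Record is_group (G : Type) (e : G) (mul : G -> G -> G) (inv : G -> G) : Prop := IsGroup {
  gmulA : forall a b c, mul (mul a b) c = mul a (mul b c);
  gmul1l : forall a, mul e a = a;
  gmul1r : forall a, mul a e = a;
  gmulVl : forall a, mul (inv a) a = e;
  gmulVr : forall a, mul a (inv a) = e
}.

Section GroupTheory.
Variables (G : Type) (e : G) (mul : G -> G -> G) (inv : G -> G).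
Hypothesis gG : is_group e mul inv.

Lemma gmulKl a b : mul (inv a) (mul a b) = b.
Proof. by rewrite -(gmulA gG) (gmulVl gG) (gmul1l gG). Qed.

Lemma gmulVKl a b : mul a (mul (inv a) b) = b.
Proof. by rewrite -(gmulA gG) (gmulVr gG) (gmul1l gG). Qed.

Lemma ginv_unique a b : mul a b = e -> b = inv a.
Proof. by move=> ab; rewrite -[b in LHS](gmulKl a) ab (gmul1r gG). Qed.

Lemma ginvK a : inv (inv a) = a.
Proof. by symmetry; apply: ginv_unique; exact: gmulVl gG a. Qed.

Lemma ginv1 : inv e = e.
Proof. by symmetry; apply: ginv_unique; exact: gmul1l gG e. Qed.

Lemma ginvM a b : inv (mul a b) = mul (inv b) (inv a).
Proof.
by symmetry; apply: ginv_unique; rewrite (gmulA gG) gmulVKl (gmulVr gG).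
Qed.

Lemma gmul_injr a b c : mul a b = mul a c -> b = c.
Proof. by move=> abc; rewrite -(gmulKl a b) abc gmulKl. Qed.
End GroupTheory.

(** The neutral element [z] of the sum is kept apart from [e] because a Hopf brace comes with two
    units. *)
Record is_brace (G : Type) (e : G) (mul : G -> G -> G) (inv : G -> G)
    (z : G) (add : G -> G -> G) (neg : G -> G) : Prop := IsBrace {
  brace_add : is_group z add neg;
  brace_dist : forall a b c,
    mul a (add b c) = add (mul a b) (add (neg a) (mul a c))
}.

(** With [a + b] for [mul a (m a b)], [triple_add] says that each [m a] is additive, and
    [triple_inv] that [a + u a = e]. *)
Record is_triple (G : Type) (e : G) (mul : G -> G -> G) (inv : G -> G)
    (m : G -> G -> G) (u : G -> G) : Prop := IsTriple {
  triple_1l : forall b, m e b = b;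
  triple_1r : forall a, m a e = e;
  triple_act : forall a b c, m a (m b c) = m (mul b a) c;
  triple_add : forall a b c,
    m a (mul b (m b c)) = mul (m a b) (m (m a b) (m a c));
  triple_invol : forall a, u (u a) = a;
  triple_inv : forall a, m a (u a) = inv a
}.

Record is_matching (G : Type) (e : G) (mul : G -> G -> G)
    (l r : G -> G -> G) : Prop := IsMatching {
  match_1l : forall b, l e b = b;
  match_actl : forall a b c, l a (l b c) = l (mul a b) c;
  match_1r : forall a, r a e = a;
  match_actr : forall a b c, r (r a b) c = r a (mul b c);
  match_l1 : forall a, l a e = e;
  match_r1 : forall b, r e b = e;
  match_lM : forall a b c, l a (mul b c) = mul (l a b) (l (r a b) c);
  match_rM : forall a b c, r (mul a b) c = mul (r a (l b c)) (r b c);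
  match_mul : forall a b, mul a b = mul (l a b) (r a b)
}.

Section Correspondences.
Variables (G : Type) (e : G) (mul : G -> G -> G) (inv : G -> G).
Hypothesis gG : is_group e mul inv.

Lemma brace_zero z add neg : is_brace e mul inv z add neg -> z = e.
Proof.
(* This instance of distributivity reduces to [z = neg e], and negating it gives [e = z]. *)
case=> gA dist; have h := dist e z z.
rewrite !(gmul1l gG) (gmul1r gA) (gmul1l gA) (gmul1r gA) in h.
by rewrite -(ginvK gA e) -h (ginv1 gA).
Qed.

Lemma brace_triple z add neg : is_brace e mul inv z add neg ->
  is_triple e mul inv (fun a b => mul (inv a) (add a b)) neg.
Proof.
move=> B; have ze := brace_zero B; case: B => gA dist; subst z.
(* The standard action of a skew brace: distributivity makes each [lam a] additive and [lam] an
   action of [mul]. Since [m] is [lam] at inverses, the order of the product is reversed in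
   [triple_act]. *)
pose lam a b := add (neg a) (mul a b).
have mE a b : mul (inv a) (add a b) = lam (inv a) b.
  by rewrite dist (gmulVl gG) (gmul1l gA).
have lamD a b c : lam a (add b c) = add (lam a b) (lam a c).
  by rewrite /lam dist -!(gmulA gA).
have lam0 a : lam a e = e by rewrite /lam (gmul1r gG) (gmulVl gA).
have lamN a b : lam a (neg b) = neg (lam a b).
  by apply: (ginv_unique gA); rewrite -lamD (gmulVr gA) lam0.
have lamM a b c : lam a (lam b c) = lam (mul a b) c.
  rewrite {2}/lam lamD lamN /lam (ginvM gA) (ginvK gA) (gmulA gA) (gmulVKl gA).
  by rewrite -(gmulA gG).
split.
- by move=> b; rewrite mE (ginv1 gG) /lam (ginv1 gA) (gmul1l gA) (gmul1l gG).
- by move=> a; rewrite mE lam0.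
- by move=> a b c; rewrite !mE lamM (ginvM gG).
- by move=> a b c; rewrite !(gmulVKl gG) !mE lamD.
- exact: (ginvK gA).
- by move=> a; rewrite (gmulVr gA) (gmul1r gG).
Qed.

(** For a matched pair the involution is a conclusion rather than part of the data, so it is derived
    here from the remaining laws. *)
Section FromAction.
Variables (m : G -> G -> G) (u : G -> G).
Hypothesis m1l : forall b, m e b = b.
Hypothesis m1r : forall a, m a e = e.
Hypothesis mA : forall a b c, m a (m b c) = m (mul b a) c.
Hypothesis mD : forall a b c, m a (mul b (m b c)) = mul (m a b) (m (m a b) (m a c)).
Hypothesis mV : forall a, m a (u a) = inv a.
Let add a b := mul a (m a b).

(** Additivity of [m a] produces [m (m a b) (m a c)], which [mA] turns into [m (add a b) c]. *)
Let addA a b c : add (add a b) c = add a (add b c).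
Proof. by rewrite /add mD mA !(gmulA gG). Qed.

Let add1l a : add e a = a.
Proof. by rewrite /add m1l (gmul1l gG). Qed.

Let add1r a : add a e = a.
Proof. by rewrite /add m1r (gmul1r gG). Qed.

Let addVr a : add a (u a) = e.
Proof. by rewrite /add mV (gmulVr gG). Qed.

(** [u] picks right inverses in the monoid [add], so [a] and [u (u a)] are a left and a right
    inverse of [u a], hence equal. *)
Lemma action_invol a : u (u a) = a.
Proof. by rewrite -(add1l (u (u a))) -(addVr a) addA addVr add1r. Qed.

Lemma action_group : is_group e add u.
Proof. by split=> // a; rewrite -{2}(action_invol a) addVr. Qed.
End FromAction.

Lemma triple_brace m u : is_triple e mul inv m u ->
  is_brace e mul inv e (fun a b => mul a (m a b)) u.
Proof.
move=> T; have [m1l m1r mA mD _ mV] := T.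
have gA := action_group m1l m1r mA mD mV.
split=> // a b c.
(* This is [-a + ac] in terms of the action; it holds because adding [a] on the left of either side
   gives [ac]. *)
have -> : mul (u a) (m (u a) (mul a c)) = m (inv a) c.
  apply: (gmul_injr gA (a := a)); rewrite (gmulVKl gA).
  by rewrite mA (gmulVl gG) m1l.
by rewrite mA -!(gmulA gG) (gmulVl gG) (gmul1l gG).
Qed.

Lemma matching_triple l r : is_matching e mul l r ->
  is_triple e mul inv (fun a b => l (inv a) b) (fun a => l a (inv a)).
Proof.
case=> l1 lA r1 rA le re lM rM lr.
have t1 b : l (inv e) b = b by rewrite (ginv1 gG).
have t3 a b c : l (inv a) (l (inv b) c) = l (inv (mul b a)) c.
  by rewrite lA (ginvM gG).
have lD a b c : l a (mul b (l (inv b) c)) = mul (l a b) (l (inv (l a b)) (l a c)).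
  (* There remains [(r a b) b^-1 = (l a b)^-1 a], a rearrangement of [ab = (l a b) (r a b)]. *)
  rewrite lM !lA; congr (mul _ (l _ _)).
  by apply: (gmul_injr gG (a := l a b)); rewrite -(gmulA gG) -lr (gmulA gG) (gmulVr gG)
    (gmul1r gG) (gmulVKl gG).
have t6 a : l (inv a) (l a (inv a)) = inv a by rewrite lA (gmulVl gG).
split=> //.
exact: (action_invol (m := fun a b => l (inv a) b) t1 (fun a => le _) t3 (fun a => lD _) t6).
Qed.

(** The formula for [r] is forced by [match_mul]. Once [l] is known to be an action satisfying [lM],
    the laws of [r] follow by telescoping products. *)
Lemma triple_matching m u : is_triple e mul inv m u ->
  is_matching e mul (fun a b => m (inv a) b)
    (fun a b => mul (inv (m (inv a) b)) (mul a b)).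
Proof.
move=> T; have [m1l m1r mA mD _ mV] := T.
pose l a b := m (inv a) b; pose r a b := mul (inv (l a b)) (mul a b).
have lA a b c : l a (l b c) = l (mul a b) c by rewrite /l mA (ginvM gG).
have l1 b : l e b = b by rewrite /l (ginv1 gG).
have lr a b : mul a b = mul (l a b) (r a b) by rewrite (gmulVKl gG).
have lM a b c : l a (mul b c) = mul (l a b) (l (r a b) c).
  (* In additive terms [bc = b + l_b c], which makes additivity of [l a] applicable to a product. *)
  have -> : mul b c = mul b (m b (l b c)) by rewrite mA (gmulVl gG) m1l.
  rewrite {1}/l mD -/(l a b) -/(l a (l b c)) lA; congr (mul _ _).
  by rewrite -{1}(ginvK gG (l a b)) -/(l (inv (l a b)) _) lA.
split=> //.
- by move=> a; rewrite -/(l a e) -/(r a e) /r {1}/l m1r (ginv1 gG) (gmul1l gG) (gmul1r gG).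
- move=> a b c; rewrite -!/(l _ _) -!/(r _ _).
  by rewrite {1}/r {3}/r lM (ginvM gG) {2}/r !(gmulA gG).
- by move=> b; rewrite -!/(l _ _) l1 (gmul1l gG) (gmulVl gG).
- move=> a b c; rewrite -!/(l _ _) lA !(gmulA gG); congr (mul _ (mul _ _)).
  by rewrite (gmulVKl gG).
Qed.
End Correspondences.

(** * Points of a cocommutative Hopf algebra *)

Section CoalgebraMorphisms.
Variable C : strict_braided_category.

Record cocoalgebra : Type := Cocoalgebra {
  coco_coalg :> coalgebra C;
  coco_comm : braid coco_coalg coco_coalg ∘ comul coco_coalg = comul coco_coalg
}.

Definition cmor (T X : coalgebra C) : Type := {f : hom T X | is_coalgebra_morphism T X f}.
Definition cval (T X : coalgebra C) (f : cmor T X) : hom T X := proj1_sig f.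
Coercion cval : cmor >-> hom.

Lemma cmor_eq (T X : coalgebra C) (f g : cmor T X) : (f : hom T X) = g -> f = g.
Proof.
case: f g => f pf [g pg] /= e; move: pg; rewrite -e => pg.
by rewrite (proof_irrelevance _ pf pg).
Qed.

Lemma coalg_comp (U V W : C) (D : coalgebra_ops U) (E : coalgebra_ops V) (F : coalgebra_ops W)
    (f : hom V W) (g : hom U V) :
  is_coalgebra_morphism E F f -> is_coalgebra_morphism D E g ->
  is_coalgebra_morphism D F (f ∘ g).
Proof.
move=> [f1 f2] [g1 g2]; split; first by rewrite comp_assoc f1.
by rewrite comp_assoc f2 tensm_comp -!comp_assoc g2.
Qed.

Lemma coalg_id (T : coalgebra C) : is_coalgebra_morphism T T (idm T).
Proof. by split; rewrite ?tensm_id ?comp_idl ?comp_idr. Qed.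

Definition ccomp (T X Y : coalgebra C) (f : cmor X Y) (g : cmor T X) : cmor T Y :=
  exist _ (f ∘ g) (coalg_comp (proj2_sig f) (proj2_sig g)).

Definition cid (T : coalgebra C) : cmor T T := exist _ _ (coalg_id T).

Lemma comul_cmor (T X : coalgebra C) (f : cmor T X) : comul X ∘ f = ⟨f, f⟩.
Proof. exact: comul_pair (proj2_sig f). Qed.

Lemma counit_cmor (T X : coalgebra C) (f : cmor T X) : counit X ∘ f = counit T.
Proof. exact: proj1 (proj2_sig f). Qed.

Lemma counit_coalg (T : coalgebra C) : is_coalgebra_morphism T (unit_coalgebra C) (counit T).
Proof.
split; first by rewrite /= comp_idl.
by rewrite -/(pairing _ _) unitlV_pair.
Qed.

Definition cpair (T : cocoalgebra) (X Y : coalgebra C) (f : cmor T X) (g : cmor T Y)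
  : cmor T (tensC X Y) :=
  exist _ ⟨f, g⟩ (pair_coalg (coco_comm T) (proj2_sig f) (proj2_sig g)).

Section Projections.
Variables X Y : coalgebra C.

Lemma braid_mid_fst (Z W : C) :
  (unitr Z ⊠ unitr W) ∘ braid_mid Z W tunit tunit ∘ (idm (Z ⊗ W) ⊠ unitlV tunit) = unitr (Z ⊗ W).
Proof.
rewrite braid_midE swap_unitr (tensm_cut (unitr Z)) /unitr /unitlV.
rewrite !(eq_hom_tensr, eq_hom_tensl) !eq_hom_comp.
exact: eq_hom_irr.
Qed.

Lemma braid_mid_snd (Z W : C) :
  (unitl Z ⊠ unitl W) ∘ braid_mid tunit tunit Z W ∘ (unitlV tunit ⊠ idm (Z ⊗ W)) = unitl (Z ⊗ W).
Proof.
rewrite braid_midE swap_unitl (tensm_cut (unitl Z)) /unitl /unitlV.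
rewrite !(eq_hom_tensr, eq_hom_tensl) !eq_hom_comp.
exact: eq_hom_irr.
Qed.

Lemma fst_coalg : is_coalgebra_morphism (tensC X Y) X (unitr X ∘ (idm X ⊠ counit Y)).
Proof.
split; rewrite comp_assoc -unitr_nat -comp_assoc -tensm_comp comp_idl comp_idr /=.
  by congr (_ ∘ _); exact: eq_hom_irr.
rewrite tensm_comp -comp_assoc (comp_assoc _ (braid_mid _ _ _ _)).
rewrite -braid_mid_nat -(comp_assoc (braid_mid _ _ _ _)) -tensm_comp tensm_id comp_idl.
rewrite -/(pairing _ _) unitlV_pair -[comul X in RHS]comp_idl tensm_comp.
by rewrite -braid_mid_fst -!comp_assoc.
Qed.

Lemma snd_coalg : is_coalgebra_morphism (tensC X Y) Y (unitl Y ∘ (counit X ⊠ idm Y)).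
Proof.
split; rewrite comp_assoc -unitl_nat -comp_assoc -tensm_comp comp_idl comp_idr //=.
rewrite tensm_comp -comp_assoc (comp_assoc _ (braid_mid _ _ _ _)).
rewrite -braid_mid_nat -(comp_assoc (braid_mid _ _ _ _)) -tensm_comp tensm_id comp_idl.
rewrite -/(pairing _ _) unitlV_pair -[comul Y in RHS]comp_idl tensm_comp.
by rewrite -braid_mid_snd -!comp_assoc.
Qed.

Definition cfst : cmor (tensC X Y) X := exist _ _ fst_coalg.
Definition csnd : cmor (tensC X Y) Y := exist _ _ snd_coalg.

Lemma cfst_pair (T : cocoalgebra) (f : cmor T X) (g : cmor T Y) : ccomp cfst (cpair f g) = f.
Proof.
apply: cmor_eq; rewrite /= /cval /= -comp_assoc tensm_pair comp_idl.
by rewrite (proj1 (proj2_sig g)) unitr_pair.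
Qed.

Lemma csnd_pair (T : cocoalgebra) (f : cmor T X) (g : cmor T Y) : ccomp csnd (cpair f g) = g.
Proof.
apply: cmor_eq; rewrite /= /cval /= -comp_assoc tensm_pair comp_idl.
by rewrite (proj1 (proj2_sig f)) unitl_pair.
Qed.

(** The projections are thus the generic pair of points: evaluating a morphism on them returns the
    morphism. *)
Lemma pair_fst_snd : ⟨cfst, csnd⟩ = idm (X ⊗ Y).
Proof.
rewrite /pairing /= /cval /= tensm_comp -comp_assoc (comp_assoc _ (braid_mid _ _ _ _)).
rewrite -braid_mid_nat -(comp_assoc (braid_mid _ _ _ _)) braid_mid_unitm comp_idl -!tensm_comp.
rewrite (comul_unitl (coalg_laws Y)) (comul_unitr (coalg_laws X)) unitrVK unitlVK.
exact: tensm_id.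
Qed.
End Projections.
End CoalgebraMorphisms.

Section Points.
Variables (C : strict_braided_category) (X : coalgebra C).
Hypothesis cocX : braid X X ∘ comul X = comul X.
Hypothesis symX : braid X X ∘ braid X X = idm (X ⊗ X).

Lemma sym_tens : braid (X ⊗ X) X ∘ braid X (X ⊗ X) = idm (X ⊗ (X ⊗ X)).
Proof.
rewrite braid_tensl braid_tensr -!comp_assoc (comp_assoc (assoc X X X) (assocV X X X)) assocVK.
rewrite comp_idl (comp_assoc (idm X ⊠ _) (idm X ⊠ _)) -tensm_comp symX comp_idl tensm_id comp_idl.
rewrite (comp_assoc (assocV X X X) (assoc X X X)) assocK comp_idl.
rewrite (comp_assoc (_ ⊠ idm X) (_ ⊠ idm X)) -tensm_comp symX comp_idl tensm_id comp_idl.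
exact: assocVK.
Qed.

Definition coco1 : cocoalgebra C := Cocoalgebra cocX.
Definition coco2 : cocoalgebra C := @Cocoalgebra C (tensC X X) (tens_cocommutative cocX cocX symX).
Definition coco3 : cocoalgebra C :=
  @Cocoalgebra C (tensC X coco2) (tens_cocommutative cocX (coco_comm coco2) sym_tens).

Notation point T := (cmor T X).
Notation op1 := (cmor X X).
Notation op2 := (cmor (tensC X X) X).

Definition app2 (w : op2) (T : cocoalgebra C) (x y : point T) : point T := ccomp w (cpair x y).

(** The Yoneda argument, here with [idm X] as generic point. The target is any object and [f], [g]
    are any morphisms, as the two sides of a law need not be coalgebra morphisms into [X]. *)
Lemma points1 (U : C) (f g : hom X U) :
  (forall (T : cocoalgebra C) (x : point T), f ∘ x = g ∘ x) -> f = g.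
Proof. by move/(_ coco1 (cid X)); rewrite /cval /= !comp_idr. Qed.

Lemma points2 (U : C) (f g : hom (X ⊗ X) U) :
  (forall (T : cocoalgebra C) (x y : point T), f ∘ ⟨x, y⟩ = g ∘ ⟨x, y⟩) -> f = g.
Proof. by move/(_ coco2 (cfst X X) (csnd X X)); rewrite pair_fst_snd !comp_idr. Qed.

Lemma points3 (U : C) (f g : hom (X ⊗ (X ⊗ X)) U) :
  (forall (T : cocoalgebra C) (x y z : point T), f ∘ ⟨x, ⟨y, z⟩⟩ = g ∘ ⟨x, ⟨y, z⟩⟩) -> f = g.
Proof.
move/(_ coco3 (cfst X coco2) (ccomp (cfst X X) (csnd X coco2)) (ccomp (csnd X X) (csnd X coco2))).
rewrite /= -(pair_comp _ _ (snd_coalg X coco2)) pair_fst_snd comp_idl.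
by rewrite (pair_fst_snd X coco2) !comp_idr.
Qed.

Lemma points3l (U : C) (f g : hom ((X ⊗ X) ⊗ X) U) :
  (forall (T : cocoalgebra C) (x y z : point T), f ∘ ⟨⟨x, y⟩, z⟩ = g ∘ ⟨⟨x, y⟩, z⟩) -> f = g.
Proof.
move=> e; rewrite -[f]comp_idr -[g]comp_idr -(assocK X X X) !comp_assoc; congr (_ ∘ _).
apply: points3 => T x y z; rewrite -!comp_assoc assocV_pair; exact: e.
Qed.

Lemma points_unitl (U : C) (f g : hom (tunit ⊗ X) U) :
  (forall (T : cocoalgebra C) (x : point T), f ∘ ⟨counit T, x⟩ = g ∘ ⟨counit T, x⟩) -> f = g.
Proof.
move=> e; rewrite -[f]comp_idr -[g]comp_idr -(unitlK X) !comp_assoc; congr (_ ∘ _).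
by apply: points1 => T x; rewrite -!comp_assoc -unitlV_pair.
Qed.

Lemma points_unitr (U : C) (f g : hom (X ⊗ tunit) U) :
  (forall (T : cocoalgebra C) (x : point T), f ∘ ⟨x, counit T⟩ = g ∘ ⟨x, counit T⟩) -> f = g.
Proof.
move=> e; rewrite -[f]comp_idr -[g]comp_idr -(unitrK X) !comp_assoc; congr (_ ∘ _).
by apply: points1 => T x; rewrite -!comp_assoc -unitrV_pair.
Qed.

(** Naturality in the stage: a formula stated for generic points specializes to all points. *)
Lemma app2_ccomp (S T : cocoalgebra C) (w : op2) (x y : point T) (t : cmor S T) :
  ccomp (app2 w x y) t = app2 w (ccomp x t) (ccomp y t).
Proof. by apply: cmor_eq; rewrite /= -comp_assoc (pair_comp _ _ (proj2_sig t)). Qed.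

Lemma ccompA (T S Y Z : coalgebra C) (f : cmor Y Z) (g : cmor S Y) (h : cmor T S) :
  ccomp (ccomp f g) h = ccomp f (ccomp g h).
Proof. by apply: cmor_eq; rewrite /= comp_assoc. Qed.

Lemma cval_ccomp (T S Y : coalgebra C) (f : cmor S Y) (g : cmor T S) :
  ccomp f g = f ∘ g :> hom _ _.
Proof. by []. Qed.

Lemma app2E (T : cocoalgebra C) (w : op2) (x y : point T) : app2 w x y = w ∘ ⟨x, y⟩ :> hom T X.
Proof. by []. Qed.

Section HopfPoints.
Variable H : hopf_on X.

Definition mulp : op2 := exist _ (mu H) (mu_coalg H).
Definition invp : op1 := exist _ (antip H) (antip_coalg H cocX).
Definition onep (T : cocoalgebra C) : point T :=
  exist _ (eta H ∘ counit T) (coalg_comp (eta_coalg H) (counit_coalg T)).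

Lemma cval_mulp : mulp = mu H :> hom _ _.
Proof. by []. Qed.
Lemma cval_invp : invp = antip H :> hom _ _.
Proof. by []. Qed.
Lemma cval_onep (T : cocoalgebra C) : onep T = eta H ∘ counit T :> hom _ _.
Proof. by []. Qed.

Lemma hopf_group (T : cocoalgebra C) : is_group (onep T) (@app2 mulp T) (ccomp invp).
Proof.
split=> [a b c|a|a|a|a]; apply: cmor_eq;
  rewrite !app2E ?cval_ccomp ?cval_onep ?cval_mulp ?cval_invp.
- rewrite -[cval c in LHS]comp_idl -[cval a in RHS]comp_idl -!tensm_pair.
  by rewrite comp_assoc mu_assoc -!comp_assoc assoc_pair.
- by rewrite -[cval a in LHS]comp_idl -tensm_pair comp_assoc mu_unitl unitl_pair.
- by rewrite -[cval a in LHS]comp_idl -tensm_pair comp_assoc mu_unitr unitr_pair.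
- rewrite -[X in ⟨_, X⟩]comp_idl -(pair_comp _ _ (proj2_sig a)) comp_assoc antipl_pair.
  by rewrite -comp_assoc counit_cmor.
- rewrite -[X in ⟨X, _⟩]comp_idl -(pair_comp _ _ (proj2_sig a)) comp_assoc antipr_pair.
  by rewrite -comp_assoc counit_cmor.
Qed.
End HopfPoints.

Section HopfOfGroup.
Variables (e : hom tunit X) (e_coalg : is_coalgebra_morphism (unit_coalgebra C) X e).
Variables (m : op2) (s : op1).
Definition const_point (T : cocoalgebra C) : point T :=
  exist _ (e ∘ counit T) (coalg_comp e_coalg (counit_coalg T)).
Hypothesis gp : forall T : cocoalgebra C, is_group (const_point T) (@app2 m T) (ccomp s).

Lemma group_algebra :
  m ∘ (e ⊠ idm X) = unitl X /\ m ∘ (idm X ⊠ e) = unitr X /\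
  m ∘ (m ⊠ idm X) = m ∘ (idm X ⊠ m) ∘ assoc X X X.
Proof.
split; last split.
- apply: points_unitl => T x; rewrite -comp_assoc tensm_pair comp_idl unitl_pair.
  exact: (f_equal (@cval _ _ _) (gmul1l (gp T) x)).
- apply: points_unitr => T x; rewrite -comp_assoc tensm_pair comp_idl unitr_pair.
  exact: (f_equal (@cval _ _ _) (gmul1r (gp T) x)).
- apply: points3l => T x y z; rewrite -!comp_assoc assoc_pair !tensm_pair !comp_idl.
  exact: (f_equal (@cval _ _ _) (gmulA (gp T) x y z)).
Qed.

Lemma group_antip :
  m ∘ (s ⊠ idm X) ∘ comul X = e ∘ counit X /\ m ∘ (idm X ⊠ s) ∘ comul X = e ∘ counit X.
Proof.
split; apply: points1 => T x; rewrite -!comp_assoc comul_cmor tensm_pair comp_idl counit_cmor.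
- exact: (f_equal (@cval _ _ _) (gmulVl (gp T) x)).
- exact: (f_equal (@cval _ _ _) (gmulVr (gp T) x)).
Qed.

(** The converse of [hopf_group]. The bialgebra compatibilities are already contained in [m] and [e]
    being coalgebra morphisms; only algebra and antipode laws come from the groups. *)
Definition group_hopf : hopf_on X :=
  @HopfOn C X
    (@AlgebraOn C X e m
       (proj1 group_algebra) (proj1 (proj2 group_algebra)) (proj2 (proj2 group_algebra)))
    s e_coalg (proj2_sig m) (proj1 group_antip) (proj2 group_antip).
End HopfOfGroup.

End Points.

(** * The laws in terms of points *)

Section PointwiseLaws.
Variables (C : strict_braided_category) (A : hopf_algebra C).
Hypothesis cocA : cocommutative A.
Let symA : braid A A ∘ braid A A = idm (A ⊗ A) := braid_invol A cocA.

Notation point T := (cmor T A).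
Notation op1 := (cmor A A).
Notation op2 := (cmor (tensC A A) A).
Notation one := (onep A).
Notation mul := (app2 (mulp A)).
Notation inv := (ccomp (invp cocA A)).

Section Evaluation.
Variable T : cocoalgebra C.
Implicit Types a b c : point T.

Lemma comul_id_pair a b c :
  braid_mid A A A A ∘ ((comul A ⊠ idm (A ⊗ A)) ∘ ⟨a, ⟨b, c⟩⟩) = ⟨⟨a, b⟩, ⟨a, c⟩⟩.
Proof. by rewrite tensm_pair comul_cmor comp_idl braid_mid_pair //; exact: coco_comm. Qed.

Lemma comul_comul_pair a b :
  braid_mid A A A A ∘ ((comul A ⊠ comul A) ∘ ⟨a, b⟩) = ⟨⟨a, b⟩, ⟨a, b⟩⟩.
Proof. by rewrite tensm_pair !comul_cmor braid_mid_pair //; exact: coco_comm. Qed.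

Lemma Gamma_pair (H1 H2 : hopf_on A) a b :
  Gamma H1 H2 ∘ ⟨a, b⟩ = app2 (mulp H1) (ccomp (invp cocA H1) a) (app2 (mulp H2) a b).
Proof.
by rewrite /Gamma -!comp_assoc tensm_pair comul_cmor comp_idl assoc_pair tensm_pair.
Qed.

Lemma mu_tilde_pair (w : op2) a b : mu_tilde w ∘ ⟨a, b⟩ = mul a (app2 w a b).
Proof.
by rewrite /mu_tilde -!comp_assoc tensm_pair comul_cmor comp_idl assoc_pair tensm_pair comp_idl.
Qed.

Lemma Psi_pair (l r : op2) a b : @Psi C A A l r ∘ ⟨a, b⟩ = ⟨app2 l a b, app2 r a b⟩.
Proof.
by rewrite /Psi -(comp_assoc _ _ ⟨_, _⟩) -(comp_assoc (l ⊠ r)) comul_comul_pair tensm_pair.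
Qed.

Lemma mu_op_pair a b : mu_op A ∘ ⟨a, b⟩ = mul b a.
Proof. by rewrite /mu_op -comp_assoc braidV_pair //; exact: coco_comm. Qed.
End Evaluation.

Lemma brace_law_points (H1 : hopf_on A) :
  brace_law H1 A <->
  forall (T : cocoalgebra C) (a b c : point T),
    mul a (app2 (mulp H1) b c)
    = app2 (mulp H1) (mul a b) (app2 (mulp H1) (ccomp (invp cocA H1) a) (mul a c)).
Proof.
have evl (T : cocoalgebra C) (a b c : point T) :
    mu A ∘ (idm A ⊠ mu H1) ∘ ⟨a, ⟨b, c⟩⟩ = mul a (app2 (mulp H1) b c).
  by rewrite -comp_assoc tensm_pair comp_idl.
have evr (T : cocoalgebra C) (a b c : point T) :
    mu H1 ∘ (mu A ⊠ Gamma H1 A) ∘ braid_mid A A A A ∘ (comul A ⊠ idm (A ⊗ A)) ∘ ⟨a, ⟨b, c⟩⟩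
    = app2 (mulp H1) (mul a b) (app2 (mulp H1) (ccomp (invp cocA H1) a) (mul a c)).
  rewrite -(comp_assoc _ _ ⟨_, _⟩) -(comp_assoc _ (braid_mid _ _ _ _)) comul_id_pair.
  by rewrite -comp_assoc tensm_pair Gamma_pair.
split=> [h T a b c|h].
- by apply: cmor_eq; rewrite -evl -evr h.
- by apply: (points3 cocA symA) => T a b c; rewrite evl evr h.
Qed.

(** Conditions (i) and (vi) of a triple are carried by the types of [w] and [s]. *)
Lemma triple_points (w : op2) (s : op1) :
  is_opposite_brace_triple w s <->
  forall T : cocoalgebra C, is_triple (one T) (@app2 _ _ (mulp A) T) inv (@app2 _ _ w T) (ccomp s).
Proof.
have e1 (T : cocoalgebra C) (b : point T) : w ∘ (eta A ⊠ idm A) ∘ ⟨counit T, b⟩ = app2 w (one T) b.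
  by rewrite -comp_assoc tensm_pair comp_idl.
have e2l (T : cocoalgebra C) (a : point T) : w ∘ (idm A ⊠ eta A) ∘ ⟨a, counit T⟩ = app2 w a (one T).
  by rewrite -comp_assoc tensm_pair comp_idl.
have e2r (T : cocoalgebra C) (a : point T) : unitl A ∘ (counit A ⊠ eta A) ∘ ⟨a, counit T⟩ = one T.
  by rewrite -comp_assoc tensm_pair counit_cmor unitl_pair.
have e3l (T : cocoalgebra C) (a b c : point T) :
    w ∘ (idm A ⊠ w) ∘ assoc A A A ∘ ⟨⟨a, b⟩, c⟩ = app2 w a (app2 w b c).
  by rewrite -!comp_assoc assoc_pair tensm_pair comp_idl.
have e3r (T : cocoalgebra C) (a b c : point T) :
    w ∘ (mu_op A ⊠ idm A) ∘ ⟨⟨a, b⟩, c⟩ = app2 w (mul b a) c.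
  by rewrite -comp_assoc tensm_pair comp_idl mu_op_pair.
have e4l (T : cocoalgebra C) (a b c : point T) :
    w ∘ (idm A ⊠ mu_tilde w) ∘ ⟨a, ⟨b, c⟩⟩ = app2 w a (mul b (app2 w b c)).
  by rewrite -comp_assoc tensm_pair comp_idl mu_tilde_pair.
have e4r (T : cocoalgebra C) (a b c : point T) :
    mu_tilde w ∘ (w ⊠ w) ∘ braid_mid A A A A ∘ (comul A ⊠ idm (A ⊗ A)) ∘ ⟨a, ⟨b, c⟩⟩
    = mul (app2 w a b) (app2 w (app2 w a b) (app2 w a c)).
  rewrite -(comp_assoc _ _ ⟨_, _⟩) -(comp_assoc _ (braid_mid _ _ _ _)) comul_id_pair.
  rewrite -(comp_assoc (mu_tilde w)) tensm_pair.
  exact: (mu_tilde_pair w (app2 w a b) (app2 w a c)).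
have e6 (T : cocoalgebra C) (a : point T) : w ∘ (idm A ⊠ s) ∘ comul A ∘ a = app2 w a (ccomp s a).
  by rewrite -!comp_assoc comul_cmor tensm_pair comp_idl.
split=> [[_ h1 h2 h3 h4 _ h5 h6] T|h].
- split=> [b|a|a b c|a b c|a|a]; apply: cmor_eq.
  + by rewrite -e1 h1 unitl_pair.
  + by rewrite -e2l h2 e2r.
  + by rewrite -e3l h3 e3r.
  + by rewrite -e4l h4 e4r.
  + by rewrite !cval_ccomp comp_assoc h5 comp_idl.
  + by rewrite -e6 h6.
- split; try exact: proj2_sig.
  + by apply: points_unitl => // T b; rewrite e1 (triple_1l (h T)) unitl_pair.
  + by apply: points_unitr => // T b; rewrite e2l (triple_1r (h T)) e2r.
  + by apply: (points3l cocA symA) => T a b c; rewrite e3l e3r (triple_act (h T)).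
  + by apply: (points3 cocA symA) => T a b c; rewrite e4l e4r (triple_add (h T)).
  + apply: points1 => // T a; rewrite comp_idl -[in RHS](triple_invol (h T) a).
    by rewrite -comp_assoc.
  + by apply: points1 => // T a; rewrite e6 (triple_inv (h T)).
Qed.

Lemma matching_points (l r : op2) :
  @is_matched_pair C A A l r /\ mu A = mu A ∘ @Psi C A A l r <->
  forall T : cocoalgebra C,
    is_matching (one T) (@app2 _ _ (mulp A) T) (@app2 _ _ l T) (@app2 _ _ r T).
Proof.
have el (T : cocoalgebra C) (b : point T) : l ∘ (eta A ⊠ idm A) ∘ ⟨counit T, b⟩ = app2 l (one T) b.
  by rewrite -comp_assoc tensm_pair comp_idl.
have er (T : cocoalgebra C) (b : point T) : r ∘ (idm A ⊠ eta A) ∘ ⟨b, counit T⟩ = app2 r b (one T).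
  by rewrite -comp_assoc tensm_pair comp_idl.
have ell (T : cocoalgebra C) (a b c : point T) :
    l ∘ (idm A ⊠ l) ∘ assoc A A A ∘ ⟨⟨a, b⟩, c⟩ = app2 l a (app2 l b c).
  by rewrite -!comp_assoc assoc_pair tensm_pair comp_idl.
have elm (T : cocoalgebra C) (a b c : point T) :
    l ∘ (mu A ⊠ idm A) ∘ ⟨⟨a, b⟩, c⟩ = app2 l (mul a b) c.
  by rewrite -!comp_assoc tensm_pair comp_idl.
have err (T : cocoalgebra C) (a b c : point T) :
    r ∘ (r ⊠ idm A) ∘ ⟨⟨a, b⟩, c⟩ = app2 r (app2 r a b) c.
  by rewrite -!comp_assoc tensm_pair comp_idl.
have erm (T : cocoalgebra C) (a b c : point T) :
    r ∘ (idm A ⊠ mu A) ∘ assoc A A A ∘ ⟨⟨a, b⟩, c⟩ = app2 r a (mul b c).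
  by rewrite -!comp_assoc assoc_pair tensm_pair comp_idl.
have el1 (T : cocoalgebra C) (a : point T) : l ∘ (idm A ⊠ eta A) ∘ ⟨a, counit T⟩ = app2 l a (one T).
  by rewrite -comp_assoc tensm_pair comp_idl.
have el1' (T : cocoalgebra C) (a : point T) : unitl A ∘ (counit A ⊠ eta A) ∘ ⟨a, counit T⟩ = one T.
  by rewrite -comp_assoc tensm_pair counit_cmor unitl_pair.
have er1 (T : cocoalgebra C) (a : point T) : r ∘ (eta A ⊠ idm A) ∘ ⟨counit T, a⟩ = app2 r (one T) a.
  by rewrite -comp_assoc tensm_pair comp_idl.
have er1' (T : cocoalgebra C) (a : point T) : unitr A ∘ (eta A ⊠ counit A) ∘ ⟨counit T, a⟩ = one T.
  by rewrite -comp_assoc tensm_pair counit_cmor unitr_pair.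
have emA (T : cocoalgebra C) (a b c : point T) :
    l ∘ (idm A ⊠ mu A) ∘ assoc A A A ∘ ⟨⟨a, b⟩, c⟩ = app2 l a (mul b c).
  by rewrite -!comp_assoc assoc_pair tensm_pair comp_idl.
have emA' (T : cocoalgebra C) (a b c : point T) :
    mu A ∘ (idm A ⊠ l) ∘ assoc A A A ∘ (@Psi C A A l r ⊠ idm A) ∘ ⟨⟨a, b⟩, c⟩
    = mul (app2 l a b) (app2 l (app2 r a b) c).
  rewrite -(comp_assoc _ _ ⟨_, _⟩) tensm_pair Psi_pair -!comp_assoc assoc_pair.
  by rewrite tensm_pair !comp_idl.
have emH (T : cocoalgebra C) (a b c : point T) :
    r ∘ (mu A ⊠ idm A) ∘ ⟨⟨a, b⟩, c⟩ = app2 r (mul a b) c.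
  by rewrite -!comp_assoc tensm_pair comp_idl.
have emH' (T : cocoalgebra C) (a b c : point T) :
    mu A ∘ (r ⊠ idm A) ∘ assocV A A A ∘ (idm A ⊠ @Psi C A A l r) ∘ assoc A A A ∘ ⟨⟨a, b⟩, c⟩
    = mul (app2 r a (app2 l b c)) (app2 r b c).
  by rewrite -!comp_assoc assoc_pair tensm_pair Psi_pair assocV_pair tensm_pair !comp_idl.
have emu (T : cocoalgebra C) (a b : point T) :
    mu A ∘ @Psi C A A l r ∘ ⟨a, b⟩ = mul (app2 l a b) (app2 r a b).
  by rewrite -comp_assoc Psi_pair.
split=> [[[[[h1 h2] _] [[h3 h4] _] h5 h6 h7 h8 _] h9] T|h].
- split=> [b|a b c|a|a b c|a|b|a b c|a b c|a b]; apply: cmor_eq.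
  + by rewrite -el h1 unitl_pair.
  + by rewrite -ell h2 elm.
  + by rewrite -er h3 unitr_pair.
  + by rewrite -err h4 erm.
  + by rewrite -el1 h5 el1'.
  + by rewrite -er1 h6 er1'.
  + by rewrite -emA h7 emA'.
  + by rewrite -emH h8 emH'.
  + by rewrite -emu -h9.
- split; first split.
  + split; last exact: proj2_sig.
    split; first by apply: points_unitl => // T b; rewrite el (match_1l (h T)) unitl_pair.
    by apply: (points3l cocA symA) => T a b c; rewrite ell elm (match_actl (h T)).
  + split; last exact: proj2_sig.
    split; first by apply: points_unitr => // T b; rewrite er (match_1r (h T)) unitr_pair.
    by apply: (points3l cocA symA) => T a b c; rewrite err erm (match_actr (h T)).
  + by apply: points_unitr => // T a; rewrite el1 el1' (match_l1 (h T)).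
  + by apply: points_unitl => // T a; rewrite er1 er1' (match_r1 (h T)).
  + by apply: (points3l cocA symA) => T a b c; rewrite emA emA' (match_lM (h T)).
  + by apply: (points3l cocA symA) => T a b c; rewrite emH emH' (match_rM (h T)).
  (* On points both sides of the braiding condition are the pair of [app2 r a b] and
     [app2 l a b]. *)
  + apply: (points2 cocA symA) => T a b.
    rewrite -comp_assoc Psi_pair (braid_pair (coco_comm T)).
    rewrite -(comp_assoc _ _ ⟨_, _⟩) -(comp_assoc (r ⊠ l)) comul_comul_pair.
    by rewrite tensm_pair.
  + by apply: (points2 cocA symA) => T a b; rewrite emu -(match_mul (h T)).
Qed.

Lemma app2_point_inj (v w : op2) :
  (forall (T : cocoalgebra C) (a b : point T), app2 v a b = app2 w a b) -> v = w.
Proof.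
move=> h; apply: cmor_eq; apply: (points2 cocA symA) => T a b.
exact: (f_equal (@cval _ _ _) (h T a b)).
Qed.

Lemma ccomp_point_inj (v w : op1) :
  (forall (T : cocoalgebra C) (a : point T), ccomp v a = ccomp w a) -> v = w.
Proof.
move=> h; apply: cmor_eq; apply: points1 => // T a.
exact: (f_equal (@cval _ _ _) (h T a)).
Qed.

End PointwiseLaws.

(** * The isomorphisms of categories *)

Section StructuredIsomorphism.
Variables (C : category) (X : C) (I J : Type).
Variables (P : I -> I -> hom X X -> Prop) (Q : J -> J -> hom X X -> Prop).
Hypothesis P_id : forall i, P i i (idm X).
Hypothesis P_comp : forall i j k (g f : hom X X), P j k g -> P i j f -> P i k (g ∘ f).
Hypothesis Q_id : forall i, Q i i (idm X).
Hypothesis Q_comp : forall i j k (g f : hom X X), Q j k g -> Q i j f -> Q i k (g ∘ f).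

Let D := @structured_category C I (fun _ => X) P P_id P_comp.
Let E := @structured_category C J (fun _ => X) Q Q_id Q_comp.

(** All objects of [D] have the same underlying [X], so the morphisms below [fmap F f] and
    [fmap G f] can be compared without a transport along [F i = G i]. *)
Lemma structured_functor_eq (B : category) (F G : functor B D) :
  (forall i, F i = G i) ->
  (forall i j (f : hom i j), proj1_sig (fmap F f) = proj1_sig (fmap G f)) -> F = G.
Proof.
case: F G => F0 F1 F2 F3 [G0 G1 G2 G3] /= e0.
have {e0} e : F0 = G0 by apply: functional_extensionality.
subst G0 => e1.
have {e1} e : F1 = G1.
  apply: functional_extensionality_dep => i; apply: functional_extensionality_dep => j.
  by apply: functional_extensionality => f; apply: structured_hom_eq; exact: e1.
by subst G1; congr Functor; exact: proof_irrelevance.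
Qed.

Definition structured_functor (F : I -> J)
    (PQ : forall i j f, P i j f -> Q (F i) (F j) f) : functor D E.
Proof.
refine (@Functor D E F (fun i j f => exist _ (proj1_sig f) (PQ i j _ (proj2_sig f))) _ _);
  by move=> *; apply: structured_hom_eq.
Defined.
End StructuredIsomorphism.

(** Objects, morphisms and composition agree by computation; only the proofs of the category laws
    differ. *)
Lemma full_structured_category (C : category) (I J : Type) (ob : I -> C)
    (P : forall i j, hom (ob i) (ob j) -> Prop) P_id P_comp (F : J -> I) :
  @full_subcategory (structured_category (P := P) P_id P_comp) J F
  = structured_category (ob := fun j => ob (F j)) (P := fun j j' f => P (F j) (F j') f)
      (fun j => P_id (F j)) (fun j j' j'' g f => P_comp (F j) (F j') (F j'') g f).
Proof. by congr Category; exact: proof_irrelevance. Qed.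

(** Both functors leave the underlying morphisms alone, so an isomorphism amounts to a bijection of
    objects under which the conditions on morphisms correspond. *)
Lemma structured_isomorphism (C : category) (X : C) (I J : Type)
    (P : I -> I -> hom X X -> Prop) (Q : J -> J -> hom X X -> Prop)
    P_id P_comp Q_id Q_comp (F : I -> J) (G : J -> I) :
  (forall i, G (F i) = i) -> (forall j, F (G j) = j) ->
  (forall i j f, P i j f <-> Q (F i) (F j) f) ->
  isomorphic_categories (@structured_category C I (fun _ => X) P P_id P_comp)
    (@structured_category C J (fun _ => X) Q Q_id Q_comp).
Proof.
move=> FK GK PQ.
have QP i j f : Q i j f -> P (G i) (G j) f by move=> h; apply/PQ; rewrite !GK.
exists (structured_functor P_id P_comp Q_id Q_comp (fun i j f => proj1 (PQ i j f))).
exists (structured_functor Q_id Q_comp P_id P_comp QP).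
by split; apply: structured_functor_eq.
Qed.

Lemma hopf_on_eq (C : strict_braided_category) (X : coalgebra C) (H H' : hopf_on X) :
  eta H = eta H' -> mu H = mu H' -> antip H = antip H' -> H = H'.
Proof.
case: H H' => [[e m a1 a2 a3] s b1 b2 b3 b4] [[e' m' a1' a2' a3'] s' b1' b2' b3' b4'] /=.
move=> ? ? ?; subst e' m' s'.
have ? : a1' = a1 by exact: proof_irrelevance.
have ? : a2' = a2 by exact: proof_irrelevance.
have ? : a3' = a3 by exact: proof_irrelevance.
subst a1' a2' a3'.
by congr HopfOn; exact: proof_irrelevance.
Qed.

(** * The correspondences of objects and morphisms over a fixed cocommutative Hopf algebra *)

Section Isomorphisms.
Variables (C : strict_braided_category) (A : hopf_algebra C).
Hypothesis cocA : cocommutative A.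
Let symA : braid A A ∘ braid A A = idm (A ⊗ A) := braid_invol A cocA.

Notation point T := (cmor T A).
Notation op1 := (cmor A A).
Notation op2 := (cmor (tensC A A) A).
Notation one := (onep A).
Notation mul := (app2 (mulp A)).
Notation inv := (ccomp (invp cocA A)).
(** A word in the generic points [p], [q], formed in the group of points of [A2], is a morphism from
    [A ⊗ A] to [A] that is a coalgebra morphism by construction. The operations below are defined in
    this way. *)
Let A2 : cocoalgebra C := coco2 cocA symA.
Let p : point A2 := cfst A A.
Let q : point A2 := csnd A A.

Let group (T : cocoalgebra C) : is_group (one T) (@app2 _ _ (mulp A) T) inv.
Proof. exact: hopf_group. Qed.

Definition brace_action (H1 : hopf_on A) : op2 :=
  (mul (inv p) (app2 (mulp H1) p q) : point A2).
Definition action_sum (w : op2) : op2 := (mul p (w : point A2) : point A2).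
(** Passes from [m] to [l] and, being an involution, also from [l] to [m]. *)
Definition twist (w : op2) : op2 := (app2 w (inv p) q : point A2).
(* The additive inverse is [l_a (a^-1)], since [a + l_a b = a b]. *)
Definition matching_neg (l : op2) : op1 :=
  @app2 _ _ l (coco1 cocA) (cid A) (invp cocA A).
Definition triple_right (w : op2) : op2 :=
  (mul (inv (app2 w (inv p) q)) (mul p q) : point A2).

Section Evaluation.
Variables (T : cocoalgebra C) (a b : point T).

Let pE : ccomp p (cpair a b) = a. Proof. exact: cfst_pair. Qed.
Let qE : ccomp q (cpair a b) = b. Proof. exact: csnd_pair. Qed.

Lemma app2_brace_action H1 : app2 (brace_action H1) a b = mul (inv a) (app2 (mulp H1) a b).
Proof.
rewrite {1}/app2 /brace_action.
by rewrite (@app2_ccomp _ _ _ A2) ccompA (@app2_ccomp _ _ _ A2) pE qE.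
Qed.

Lemma app2_action_sum w : app2 (action_sum w) a b = mul a (app2 w a b).
Proof. by rewrite {1}/app2 /action_sum (@app2_ccomp _ _ _ A2) pE. Qed.

Lemma app2_twist l : app2 (twist l) a b = app2 l (inv a) b.
Proof. by rewrite {1}/app2 /twist (@app2_ccomp _ _ _ A2) ccompA pE qE. Qed.

Lemma ccomp_matching_neg l : ccomp (matching_neg l) a = app2 l a (inv a).
Proof.
rewrite /matching_neg (@app2_ccomp _ _ _ (coco1 cocA)); congr (app2 l _ _).
by apply: cmor_eq; rewrite cval_ccomp comp_idl.
Qed.

Lemma app2_triple_right w :
  app2 (triple_right w) a b = mul (inv (app2 w (inv a) b)) (mul a b).
Proof.
rewrite {1}/app2 /triple_right (@app2_ccomp _ _ _ A2) ccompA.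
by rewrite !(@app2_ccomp _ _ _ A2) ccompA pE qE.
Qed.
End Evaluation.

Lemma brace_points (H1 : hopf_on A) (T : cocoalgebra C) : brace_law H1 A ->
  is_brace (one T) (@app2 _ _ (mulp A) T) inv
    (onep H1 T) (@app2 _ _ (mulp H1) T) (ccomp (invp cocA H1)).
Proof. by move=> h; split; [exact: hopf_group | exact: (proj1 (brace_law_points cocA H1) h T)]. Qed.

Lemma brace_eta (H1 : hopf_on A) : brace_law H1 A -> eta H1 = eta A.
Proof.
move=> h; have e := brace_zero (group (coco1 cocA)) (brace_points (coco1 cocA) h).
have {}e : eta H1 ∘ counit A = eta A ∘ counit A := f_equal (@cval _ _ _) e.
(* The group argument yields equality of the units only after composition with [counit A], which
   this section cancels. *)
have eK : counit A ∘ eta A = idm tunit := proj1 (eta_coalg A).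
by rewrite -[eta H1]comp_idr -eK comp_assoc e -comp_assoc eK comp_idr.
Qed.

Lemma brace_action_triple (H1 : hopf_on A) : brace_law H1 A ->
  is_opposite_brace_triple (brace_action H1) (invp cocA H1).
Proof.
move=> h; apply/(triple_points cocA) => T.
have -> : @app2 _ _ (brace_action H1) T = fun a b => mul (inv a) (app2 (mulp H1) a b).
  by do 2 apply: functional_extensionality => ?; exact: app2_brace_action.
exact (brace_triple (group T) (brace_points T h)).
Qed.

Lemma action_sum_app w T :
  @app2 _ _ (action_sum w) T = fun a b => mul a (app2 w a b).
Proof. by do 2 apply: functional_extensionality => ?; exact: app2_action_sum. Qed.

Lemma twist_app w T : @app2 _ _ (twist w) T = fun a b => app2 w (inv a) b.
Proof. by do 2 apply: functional_extensionality => ?; exact: app2_twist. Qed.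

Lemma action_sum_group (w : op2) (s : op1) : is_opposite_brace_triple w s ->
  forall T : cocoalgebra C,
    is_group (const_point (eta_coalg A) T) (@app2 _ _ (action_sum w) T) (ccomp s).
Proof.
move=> /(triple_points cocA) h T; rewrite action_sum_app.
exact (brace_add (triple_brace (group T) (h T))).
Qed.

Definition triple_hopf (w : op2) (s : op1) (h : is_opposite_brace_triple w s) : hopf_on A :=
  group_hopf cocA symA (action_sum_group h).

Lemma mulp_triple_hopf (w : op2) (s : op1) (h : is_opposite_brace_triple w s) :
  mulp (triple_hopf h) = action_sum w.
Proof. exact: cmor_eq. Qed.

Lemma invp_triple_hopf (w : op2) (s : op1) (h : is_opposite_brace_triple w s) :
  invp cocA (triple_hopf h) = s.
Proof. exact: cmor_eq. Qed.

Lemma triple_hopf_brace (w : op2) (s : op1) (h : is_opposite_brace_triple w s) :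
  brace_law (triple_hopf h) A.
Proof.
apply/(brace_law_points cocA) => T; rewrite mulp_triple_hopf invp_triple_hopf action_sum_app.
have t : is_triple _ _ _ _ _ := proj1 (triple_points cocA w s) h T.
exact (brace_dist (triple_brace (group T) t)).
Qed.

Lemma matching_is_triple (l r : op2) :
  is_matched_pair (A := A) (H := A) l r /\ mu A = mu A ∘ Psi (A := A) (H := A) l r ->
  is_opposite_brace_triple (twist l) (matching_neg l).
Proof.
move=> /(matching_points cocA) h; apply/(triple_points cocA) => T.
have -> : @ccomp _ T _ _ (matching_neg l) = fun a => app2 l a (inv a).
  by apply: functional_extensionality => a; exact: ccomp_matching_neg.
rewrite twist_app; exact (matching_triple (group T) (h T)).
Qed.

Lemma triple_is_matching (w : op2) (s : op1) : is_opposite_brace_triple w s ->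
  is_matched_pair (A := A) (H := A) (twist w) (triple_right w) /\
  mu A = mu A ∘ Psi (A := A) (H := A) (twist w) (triple_right w).
Proof.
move=> /(triple_points cocA) h; apply/(matching_points cocA) => T.
have -> : @app2 _ _ (triple_right w) T = fun a b => mul (inv (app2 w (inv a) b)) (mul a b).
  by do 2 apply: functional_extensionality => ?; exact: app2_triple_right.
rewrite twist_app; exact (triple_matching (group T) (h T)).
Qed.

Lemma twistK w : twist (twist w) = w.
Proof.
apply: (app2_point_inj cocA) => T a b.
by rewrite !app2_twist (ginvK (group T)).
Qed.

Lemma action_sum_brace (H1 : hopf_on A) : action_sum (brace_action H1) = mulp H1.
Proof.
apply: (app2_point_inj cocA) => T a b.
by rewrite app2_action_sum app2_brace_action (gmulVKl (group T)).
Qed.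

Lemma brace_action_hopf (w : op2) (s : op1) (h : is_opposite_brace_triple w s) :
  brace_action (triple_hopf h) = w.
Proof.
apply: (app2_point_inj cocA) => T a b.
by rewrite app2_brace_action mulp_triple_hopf app2_action_sum (gmulKl (group T)).
Qed.

Lemma matching_right_twist (l r : op2) :
  is_matched_pair (A := A) (H := A) l r /\ mu A = mu A ∘ Psi (A := A) (H := A) l r ->
  triple_right (twist l) = r.
Proof.
move=> /(matching_points cocA) h; apply: (app2_point_inj cocA) => T a b.
rewrite app2_triple_right app2_twist (ginvK (group T)) (match_mul (h T) a b).
by rewrite (gmulKl (group T)).
Qed.

(** [u] is determined by [m]: applying [m] at [a^-1] to [m_a (u a) = a^-1] isolates [u a]. *)
Lemma triple_neg (w : op2) (s : op1) : is_opposite_brace_triple w s ->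
  matching_neg (twist w) = s.
Proof.
move=> /(triple_points cocA) h; apply: (ccomp_point_inj cocA) => T a.
rewrite ccomp_matching_neg app2_twist -{2}(triple_inv (h T) a) (triple_act (h T)).
by rewrite (gmulVr (group T)) (triple_1l (h T)).
Qed.

Section Morphisms.
Variable f : op1.

Lemma preserves_points (w w' : op2) :
  f ∘ w = w' ∘ (f ⊠ f) <->
  forall (T : cocoalgebra C) (a b : point T),
    ccomp f (app2 w a b) = app2 w' (ccomp f a) (ccomp f b).
Proof.
have ev (T : cocoalgebra C) (a b : point T) :
    w' ∘ (f ⊠ f) ∘ ⟨a, b⟩ = app2 w' (ccomp f a) (ccomp f b).
  by rewrite -comp_assoc tensm_pair.
split=> [e T a b|e].
- by apply: cmor_eq; rewrite -ev -e cval_ccomp app2E comp_assoc.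
- by apply: (points2 cocA symA) => T a b; rewrite ev -e cval_ccomp app2E comp_assoc.
Qed.

Hypothesis fA : is_hopf_morphism (A := A) (B := A) f.

Let f1 T : ccomp f (one T) = one T.
Proof. by apply: cmor_eq; rewrite cval_ccomp cval_onep comp_assoc (proj1 (proj1 fA)). Qed.

Let fM (T : cocoalgebra C) (a b : point T) : ccomp f (mul a b) = mul (ccomp f a) (ccomp f b).
Proof. by move: T a b; apply/preserves_points; exact: proj2 (proj1 fA). Qed.

Let fV (T : cocoalgebra C) (a : point T) : ccomp f (inv a) = inv (ccomp f a).
Proof. by apply: (ginv_unique (group T)); rewrite -fM (gmulVr (group T)) f1. Qed.

Lemma preserves_action_sum (w w' : op2) :
  f ∘ w = w' ∘ (f ⊠ f) -> f ∘ action_sum w = action_sum w' ∘ (f ⊠ f).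
Proof.
move=> /preserves_points h; apply/preserves_points => T a b.
by rewrite !app2_action_sum fM h.
Qed.

Lemma preserves_brace_action (H1 H1' : hopf_on A) :
  f ∘ mu H1 = mu H1' ∘ (f ⊠ f) <->
  f ∘ brace_action H1 = brace_action H1' ∘ (f ⊠ f).
Proof.
split=> [/(preserves_points (mulp H1) (mulp H1')) h|/preserves_action_sum].
- by apply/preserves_points => T a b; rewrite !app2_brace_action fM fV h.
- by rewrite !action_sum_brace.
Qed.

Lemma preserves_twist (w w' : op2) :
  f ∘ w = w' ∘ (f ⊠ f) -> f ∘ twist w = twist w' ∘ (f ⊠ f).
Proof.
move=> /preserves_points h; apply/preserves_points => T a b.
by rewrite !app2_twist h fV.
Qed.

Lemma preserves_triple_right (w w' : op2) :
  f ∘ w = w' ∘ (f ⊠ f) -> f ∘ triple_right w = triple_right w' ∘ (f ⊠ f).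
Proof.
move=> /preserves_points h; apply/preserves_points => T a b.
by rewrite !app2_triple_right fM fV h fM fV.
Qed.
End Morphisms.

Let brace_ob : Type := {H1 : hopf_on A | brace_law H1 A}.
Let triple_ob : Type :=
  {t : hom (A ⊗ A) A * hom A A | is_opposite_brace_triple (fst t) (snd t)}.

Definition triple_op2 (t : triple_ob) : op2 :=
  exist _ (fst (proj1_sig t)) (obt_m_coalg (proj2_sig t)).
Definition triple_op1 (t : triple_ob) : op1 :=
  exist _ (snd (proj1_sig t)) (obt_u_coalg (proj2_sig t)).

Lemma triple_op_law (t : triple_ob) : is_opposite_brace_triple (triple_op2 t) (triple_op1 t).
Proof. exact: proj2_sig t. Qed.

Definition brace_to_triple (B : brace_ob) : triple_ob :=
  exist _ (cval (brace_action (proj1_sig B)), cval (invp cocA (proj1_sig B)))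
    (brace_action_triple (proj2_sig B)).

Definition triple_to_brace (t : triple_ob) : brace_ob :=
  exist _ (triple_hopf (triple_op_law t)) (triple_hopf_brace (triple_op_law t)).

Definition matching_left (M : MP_ob A) : op2 :=
  exist _ (MP_left M) (proj2 (mp_left (MP_matched M))).
Definition matching_right (M : MP_ob A) : op2 :=
  exist _ (MP_right M) (proj2 (mp_right (MP_matched M))).

Lemma matching_law (M : MP_ob A) :
  is_matched_pair (A := A) (H := A) (matching_left M) (matching_right M) /\
  mu A = mu A ∘ Psi (A := A) (H := A) (matching_left M) (matching_right M).
Proof. exact: (conj (MP_matched M) (MP_mu M)). Qed.

Definition matching_to_triple (M : MP_ob A) : triple_ob :=
  exist _ (cval (twist (matching_left M)), cval (matching_neg (matching_left M)))
    (matching_is_triple (matching_law M)).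

Definition triple_to_matching (t : triple_ob) : MP_ob A :=
  MPOb (proj1 (triple_is_matching (triple_op_law t)))
    (proj2 (triple_is_matching (triple_op_law t))).

Lemma triple_ob_eq (t t' : triple_ob) :
  triple_op2 t = triple_op2 t' -> triple_op1 t = triple_op1 t' -> t = t'.
Proof.
case: t t' => [[m u] h] [[m' u'] h'] /(f_equal (@cval _ _ _)) /= e /(f_equal (@cval _ _ _)) /= e'.
rewrite /cval /= in e e'; subst m' u'; congr exist; exact: proof_irrelevance.
Qed.

Lemma MP_ob_eq (M M' : MP_ob A) :
  matching_left M = matching_left M' -> matching_right M = matching_right M' -> M = M'.
Proof.
case: M M' => [l r h k] [l' r' h' k'] /(f_equal (@cval _ _ _)) /= e /(f_equal (@cval _ _ _)) /= e'.
rewrite /cval /= in e e'; subst l' r'; congr MPOb; exact: proof_irrelevance.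
Qed.

Lemma triple_op2_brace (B : brace_ob) : triple_op2 (brace_to_triple B) = brace_action (proj1_sig B).
Proof. exact: cmor_eq. Qed.
Lemma triple_op1_brace (B : brace_ob) : triple_op1 (brace_to_triple B) = invp cocA (proj1_sig B).
Proof. exact: cmor_eq. Qed.
Lemma triple_op2_matching M : triple_op2 (matching_to_triple M) = twist (matching_left M).
Proof. exact: cmor_eq. Qed.
Lemma triple_op1_matching M : triple_op1 (matching_to_triple M) = matching_neg (matching_left M).
Proof. exact: cmor_eq. Qed.
Lemma matching_left_triple t : matching_left (triple_to_matching t) = twist (triple_op2 t).
Proof. exact: cmor_eq. Qed.
Lemma matching_right_triple t : matching_right (triple_to_matching t) = triple_right (triple_op2 t).
Proof. exact: cmor_eq. Qed.

Lemma brace_to_tripleK (B : brace_ob) : triple_to_brace (brace_to_triple B) = B.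
Proof.
case: B => H1 h.
suff e : triple_hopf (triple_op_law (brace_to_triple (exist _ H1 h))) = H1.
  rewrite /triple_to_brace; move: (triple_hopf_brace _); rewrite e => h'.
  by rewrite (proof_irrelevance _ h' h).
have e2 := f_equal (@cval _ _ _) (action_sum_brace H1).
(* The rebuilt Hopf algebra has the unit of [A], so both units of the brace must coincide. *)
apply: hopf_on_eq; first by rewrite (brace_eta h).
- rewrite -[mu H1]e2 -(triple_op2_brace (exist _ H1 h)); exact: eq_refl.
- exact: eq_refl.
Qed.

Lemma triple_to_braceK (t : triple_ob) : brace_to_triple (triple_to_brace t) = t.
Proof.
apply: triple_ob_eq; first by rewrite triple_op2_brace brace_action_hopf.
by rewrite triple_op1_brace invp_triple_hopf.
Qed.

Lemma matching_to_tripleK (M : MP_ob A) : triple_to_matching (matching_to_triple M) = M.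
Proof.
apply: MP_ob_eq.
- by rewrite matching_left_triple triple_op2_matching twistK.
- by rewrite matching_right_triple triple_op2_matching (matching_right_twist (matching_law M)).
Qed.

Lemma triple_to_matchingK (t : triple_ob) : matching_to_triple (triple_to_matching t) = t.
Proof.
apply: triple_ob_eq.
- by rewrite triple_op2_matching matching_left_triple twistK.
- by rewrite triple_op1_matching matching_left_triple (triple_neg (triple_op_law t)).
Qed.

Let brace_hom (B B' : brace_ob) (f : hom A A) : Prop :=
  @is_hopf_brace_morphism C (HopfBrace (proj2_sig B)) (HopfBrace (proj2_sig B')) f.
Let triple_hom (t t' : triple_ob) (f : hom A A) : Prop :=
  @is_opposite_brace_triple_morphism C
    (OppositeBraceTriple (proj2_sig t)) (OppositeBraceTriple (proj2_sig t')) f.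

Lemma brace_hom_triple (B B' : brace_ob) (f : hom A A) :
  brace_hom B B' f <-> triple_hom (brace_to_triple B) (brace_to_triple B') f.
Proof.
split.
- move=> [h1 h2]; have hA : is_hopf_morphism (A := A) (B := A) f := h2.
  split=> //; pose fc : op1 := exist _ f (proj2 hA).
  exact: (proj1 (@preserves_brace_action fc hA _ _) (proj2 (proj1 h1))).
- move=> [h1 h2]; have hA : is_hopf_morphism (A := A) (B := A) f := h1.
  split=> //; split; last exact: proj2 hA.
  pose fc : op1 := exist _ f (proj2 hA).
  split; last exact: (proj2 (@preserves_brace_action fc hA _ _) h2).
  rewrite /= (brace_eta (proj2_sig B)) (brace_eta (proj2_sig B')).
  exact: proj1 (proj1 hA).
Qed.

(** In the backward direction, compatibility with the right action follows because that action is a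
    group word in the product and the triple operation. *)
Lemma matching_hom_triple (M M' : MP_ob A) (f : hom A A) :
  is_MP_morphism M M' f <-> triple_hom (matching_to_triple M) (matching_to_triple M') f.
Proof.
split.
- move=> [hA [h1 h2]]; split=> //; pose fc : op1 := exist _ f (proj2 hA).
  exact: (@preserves_twist fc hA (matching_left M) (matching_left M') h1).
- move=> [hA h]; pose fc : op1 := exist _ f (proj2 hA).
  have h' : fc ∘ twist (matching_left M) = twist (matching_left M') ∘ (fc ⊠ fc) := h.
  split=> //; split.
    by have := @preserves_twist fc hA _ _ h'; rewrite !twistK.
  have := @preserves_triple_right fc hA _ _ h'.
  by rewrite (matching_right_twist (matching_law M)) (matching_right_twist (matching_law M')).
Qed.

Lemma matching_hom_brace (B B' : brace_ob) (f : hom A A) :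
  brace_hom B B' f <-> is_MP_morphism (triple_to_matching (brace_to_triple B))
    (triple_to_matching (brace_to_triple B')) f.
Proof.
apply: (iff_trans (brace_hom_triple B B' f)).
by apply: iff_sym; rewrite -{2}(triple_to_matchingK (brace_to_triple B))
  -{2}(triple_to_matchingK (brace_to_triple B')); exact: matching_hom_triple.
Qed.
End Isomorphisms.

Theorem corollary3p12 (C : strict_braided_category) (A : hopf_algebra C)
    (cocA : cocommutative A) :
  isomorphic_categories (cocHBr A) (MP A) /\
  isomorphic_categories (MP A) (coc_opBT A) /\
  isomorphic_categories (cocHBr A) (coc_opBT A).
Proof.
pose brace (B : {H1 : hopf_on A | brace_law H1 A}) := HopfBrace (proj2_sig B).
pose triple (t : {t : hom (A ⊗ A) A * hom A A | is_opposite_brace_triple (fst t) (snd t)})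
  := OppositeBraceTriple (proj2_sig t).
pose brace_id B := is_hopf_brace_morphism_id (brace B).
pose brace_comp B B' B'' := @is_hopf_brace_morphism_comp C (brace B) (brace B') (brace B'').
pose triple_id t := is_opposite_brace_triple_morphism_id (triple t).
pose triple_comp t t' t'' :=
  @is_opposite_brace_triple_morphism_comp C (triple t) (triple t') (triple t'').
have BM := @structured_isomorphism C A _ _ _ _ brace_id brace_comp
  (@is_MP_morphism_id C A) (@is_MP_morphism_comp C A)
  (fun B => triple_to_matching cocA (brace_to_triple cocA B))
  (fun M => triple_to_brace cocA (matching_to_triple cocA M)) _ _ (matching_hom_brace cocA).
have MT := @structured_isomorphism C A _ _ _ _
  (@is_MP_morphism_id C A) (@is_MP_morphism_comp C A) triple_id triple_comp
  (matching_to_triple cocA) (triple_to_matching cocA) (matching_to_tripleK cocA)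
  (triple_to_matchingK cocA) (matching_hom_triple cocA).
have BT := @structured_isomorphism C A _ _ _ _ brace_id brace_comp triple_id triple_comp
  (brace_to_triple cocA) (triple_to_brace cocA) (brace_to_tripleK cocA)
  (triple_to_braceK cocA) (brace_hom_triple cocA).
(* This brings both full subcategories to the form of structures on the constant object [A], which
   the three isomorphisms above are about. *)
rewrite /cocHBr /coc_opBT /HBr /opBT !full_structured_category.
split; last by split; [exact: MT | exact: BT].
apply: BM => [B|M].
- by rewrite triple_to_matchingK brace_to_tripleK.
- by rewrite triple_to_braceK matching_to_tripleK.
Qed.
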